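(* Let $k\ge 3$. Let $G=(V,E)$ be a $(k-2)$-connected $k$-colorable chordal graph, and let $T\subseteq V$ be a clique of $G$ with $m=|T|\ge k-2$. Then the contracted solution graph $\mathcal{C}^c_k(G,T)$ is an $(m,k)$-color-complete graph, or it is a forest that satisfies the injective neighborhood property.
   Context: Graphs are finite and simple. A $k$-coloring of $G$ is a map $\alpha:V(G)\to\{1,\dots,k\}$ with $\alpha(u)\ne\alpha(v)$ for all edges $uv$. The $k$-color graph $\mathcal{C}_k(G)$ has the $k$-colorings of $G$ as nodes, two adjacent iff they differ on exactly one vertex. A chordal graph has no induced cycle of length $>3$; for $\ell\ge1$, $G$ is $\ell$-connected if $|V(G)|\ge \ell+1$ and every vertex cut has at least $\ell$ vertices. For $T\subseteq V(G)$, give each $k$-coloring $\gamma$ of $G$ the label $\gamma|_T$. A label component is a maximal set of $k$-colorings of $G$ that all have the same label and induce a connected subgraph of $\mathcal{C}_k(G)$. The contracted solution graph $\mathcal{C}^c_k(G,T)$ is the labeled graph $(H,\ell)$ whose nodes $x$ correspond bijectively to the label components $S_x$, where distinct $x,y$ are adjacent iff some $\gamma\in S_x$ and $\gamma'\in S_y$ are adjacent in $\mathcal{C}_k(G)$, and $\ell(x)$ is the common label of the colorings in $S_x$ (so $\ell(x)$ is a $k$-coloring of $G[T]$). Labeled graphs are identified up to label-preserving isomorphism. For $1\le m\le k$, a labeled graph $(H,\ell)$ is $(m,k)$-color-complete if there is a set $T$ with $|T|=m$ such that every label $\ell(v)$ is a $k$-coloring of the complete graph on vertex set $T$, every such $k$-coloring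 is the label of exactly one node of $H$, and two nodes are adjacent iff their labels differ on exactly one element of $T$. A labeled graph $(H,\ell)$ satisfies the injective neighborhood property (INP) if for every node $u$ and any two distinct neighbors $v,w$ of $u$, $\ell(v)\ne\ell(w)$. *)

(* Defs.v *)
From mathcomp Require Import all_boot.
Set Implicit Arguments. Unset Strict Implicit. Unset Printing Implicit Defensive.

Section Defs.
Variable V : finType.

Definition simple_graph (e : rel V) : Prop := symmetric e /\ irreflexive e.

Definition proper (k : nat) (e : rel V) (a : {ffun V -> 'I_k}) : bool :=
  [forall u, forall v, e u v ==> (a u != a v)].

Definition colorable (k : nat) (e : rel V) : Prop :=
  exists a : {ffun V -> 'I_k}, proper e a.

Definition cadj (k : nat) (e : rel V) (a b : {ffun V -> 'I_k}) : bool :=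
  [&& proper e a, proper e b & #|[set v | a v != b v]| == 1].

Definition cyc_adj (n : nat) (i j : 'I_n) : bool :=
  (val j == (val i).+1 %% n) || (val i == (val j).+1 %% n).

Definition chordal (e : rel V) : Prop :=
  forall (n : nat) (c : 'I_n -> V), 4 <= n -> injective c ->
    ~ (forall i j : 'I_n, e (c i) (c j) = cyc_adj i j).

Definition del_rel (e : rel V) (S : {set V}) : rel V :=
  [rel x y | [&& e x y, x \notin S & y \notin S]].

Definition vertex_cut (e : rel V) (S : {set V}) : Prop :=
  exists x y, [/\ x \notin S, y \notin S & ~~ connect (del_rel e S) x y].

Definition l_connected (l : nat) (e : rel V) : Prop :=
  l.+1 <= #|V| /\ forall S : {set V}, vertex_cut e S -> l <= #|S|.

Definition clique (e : rel V) (T : {set V}) : Prop :=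
  forall u v, u \in T -> v \in T -> u != v -> e u v.

(* Labels: colorings of T, represented as partial maps (None outside T). *)
Definition restr (k : nat) (T : {set V}) (a : {ffun V -> 'I_k}) : {ffun V -> option 'I_k} :=
  [ffun v => if v \in T then Some (a v) else None].

Definition ladj (k : nat) (e : rel V) (T : {set V}) : rel {ffun V -> 'I_k} :=
  [rel a b | cadj e a b && (restr T a == restr T b)].

Definition lcomp (k : nat) (e : rel V) (T : {set V}) (a : {ffun V -> 'I_k})
  : {set {ffun V -> 'I_k}} := [set b | connect (ladj e T) a b].

Definition cs_nodes (k : nat) (e : rel V) (T : {set V}) : {set {set {ffun V -> 'I_k}}} :=
  [set lcomp e T a | a in [pred a | proper e a]].

Definition cs_adj (k : nat) (e : rel V) : rel {set {ffun V -> 'I_k}} :=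
  [rel X Y : {set {ffun V -> 'I_k}} | (X != Y) && [exists a in X, exists b in Y, cadj e a b]].

Definition cs_lab (k : nat) (T : {set V}) (X : {set {ffun V -> 'I_k}}) : {ffun V -> option 'I_k} :=
  match [pick a in X] with Some a => restr T a | None => [ffun _ => None] end.

Definition K_coloring (k : nat) (T : {set V}) (f : {ffun V -> option 'I_k}) : Prop :=
  (forall v, (f v != None) = (v \in T)) /\
  (forall u v, u \in T -> v \in T -> u != v -> f u != f v).

Definition color_complete (N : finType) (nodes : {set N}) (adj : rel N) (m k : nat)
  (lab : N -> {ffun V -> option 'I_k}) : Prop :=
  exists T : {set V},
  [/\ #|T| = m,
      (forall x, x \in nodes -> K_coloring T (lab x)),
      (forall f, K_coloring T f -> exists x, [/\ x \in nodes, lab x = f &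
                  forall y, y \in nodes -> lab y = f -> y = x]) &
      (forall x y, x \in nodes -> y \in nodes ->
         adj x y <-> #|[set v in T | lab x v != lab y v]| = 1)].

Definition INP (N : finType) (nodes : {set N}) (adj : rel N) (L : Type)
  (lab : N -> L) : Prop :=
  forall u v w, u \in nodes -> v \in nodes -> w \in nodes ->
    adj u v -> adj u w -> v != w -> lab v <> lab w.

Definition forest (N : finType) (nodes : {set N}) (adj : rel N) : Prop :=
  forall (n : nat) (c : 'I_n -> N), 3 <= n -> injective c ->
    (forall i, c i \in nodes) ->
    ~ (forall i j : 'I_n, val j == (val i).+1 %% n -> adj (c i) (c j)).

End Defs.

(* Main.v *)
Require Import Defs.
From mathcomp Require Import all_boot.
From mathcomp Require Import zify.

Set Implicit Arguments. Unset Strict Implicit. Unset Printing Implicit Defensive.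

(* A chordal, (k-2)-connected graph grows from any clique with at least k-2 vertices by
   adding vertices v whose present neighborhood N is a clique with at least k-2 vertices.
   Trace a recoloring path on a clique K and reduce it freely: erase stutters and
   backtracks x y x. A coloring of k-2 clique vertices leaves only two colors to a further
   vertex, so the reduced trace on N + v restricts to the reduced trace on N. Growing from
   T, a recoloring path can thus be replaced by one with the same ends whose traces are
   all reduced; if its trace on T reduces to a point, the new path never changes T, which
   gives the injective neighborhood property.
   If there is a k-clique Q, it is frozen; growing from Q, every closed path has trivial
   reduced traces. A cycle of the contracted graph would give a closed path whose trace on
   T is nontrivial and already reduced.
   Without a k-clique every N has exactly k-2 vertices, so that colorings extend and
   recoloring steps lift to each added vertex; hence a node is determined by its label. *)

(** * Words without stutters and backtracks *)

Section Words.
Variable X : eqType.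
Implicit Types (x y z : X) (s p : seq X).

(** This erases pauses only: paths with equal [dd] visit the same values in the same order and
    differ just in timing. *)
Definition cons_dd x s := if s is y :: _ then if x == y then s else x :: s else [:: x].
Definition dd s := foldr cons_dd [::] s.

(** Free reduction as for walks in a graph up to homotopy. In [red] the new letter meets an already
    reduced word, so a single cancellation at the head suffices. *)
Definition push x s :=
  if s is y :: s' then
    if x == y then s
    else if s' is z :: _ then if x == z then s' else x :: s else x :: s
  else [:: x].
Definition red s := foldr push [::] s.

Fixpoint reduced s :=
  if s is x :: s' then
    (if s' is y :: s'' then (x != y) && (if s'' is z :: _ then x != z else true)
     else true) && reduced s'
  else true.

Lemma cons_ddK x s : cons_dd x (cons_dd x s) = cons_dd x s.
Proof.
case: s => [|y s] /=; first by rewrite eqxx.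
by case: (eqVneq x y) => [->|_] /=; rewrite eqxx.
Qed.

Lemma cons_dd_cons x s : exists s', cons_dd x s = x :: s'.
Proof.
case: s => [|y s] /=; first by exists [::].
by case: (eqVneq x y) => [->|_]; [exists s | exists (y :: s)].
Qed.

Lemma push_cons x s : exists s', push x s = x :: s'.
Proof.
case: s => [|y s] /=; first by exists [::].
case: (eqVneq x y) => [->|_]; first by exists s.
case: s => [|z s]; first by exists [:: y].
by case: (eqVneq x z) => [->|_]; [exists s | exists (y :: z :: s)].
Qed.

Lemma dd_cons x s : exists s', dd (x :: s) = x :: s'.
Proof. exact: cons_dd_cons. Qed.

Lemma red_cons x s : exists s', red (x :: s) = x :: s'.
Proof. exact: push_cons. Qed.

Lemma push_top x s : push x (x :: s) = x :: s.
Proof. by rewrite /= eqxx. Qed.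

Lemma pushK x s : push x (push x s) = push x s.
Proof. by have [s' ->] := push_cons x s; exact: push_top. Qed.

Lemma dd_last x0 x s : last x0 (dd (x :: s)) = last x s.
Proof.
elim: s x x0 => [//|y s IH] x x0.
rewrite [last x _]/= -(IH y x) /= -/(dd (y :: s)).
have [s' E] := dd_cons y s; rewrite /= in E; rewrite E /=.
by case: (x == y).
Qed.

Lemma red_last x0 x s : last x0 (red (x :: s)) = last x s.
Proof.
elim: s x x0 => [//|y s IH] x x0.
rewrite [last x _]/= -(IH y x) /=.
have [s' E] := red_cons y s; rewrite /= in E; rewrite E /=.
case: (x == y) => //.
by case: s' {E} => // z s'; case: (x == z).
Qed.

Lemma reduced_push x s : reduced s -> reduced (push x s).
Proof.
case: s => [|y s] //= /andP[Hy Hs].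
case: (eqVneq x y) => [_|nxy] /=; first by rewrite Hy Hs.
case: s Hy Hs => [|z s] //=; first by rewrite nxy.
move=> /andP[nyz Hy] /andP[Hz Hs].
case: (eqVneq x z) => [_|nxz] /=; first by rewrite Hz Hs.
by rewrite nxy nxz nyz Hy Hz Hs.
Qed.

Lemma reduced_red s : reduced (red s).
Proof. by elim: s => //= x s; apply: reduced_push. Qed.

Lemma red_reduced s : reduced s -> red s = s.
Proof.
elim: s => //= x s IH /andP[Hx Hs]; rewrite (IH Hs).
case: s Hx {IH Hs} => [//|y s] /andP[nxy Hx] /=; rewrite (negbTE nxy).
by case: s Hx => // z s nxz; rewrite (negbTE nxz).
Qed.

Lemma path_push (r : rel X) x p : path r x p ->
  path r x (behead (push x p)).
Proof.
case: p => [//|y p] /= /andP[rxy rp].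
case: (eqVneq x y) => [->//|_].
case: p rp => [_|z p] /=; first by rewrite rxy.
by move=> /andP[ryz rp]; case: (eqVneq x z) => [->//|_] /=; rewrite rxy ryz.
Qed.

Lemma path_red (r : rel X) x p : path r x p -> path r x (behead (red (x :: p))).
Proof.
elim: p x => [//|y p IH] x /= /andP[rxy /IH rp].
apply: path_push; have [s' E] := red_cons y p; rewrite E /= in rp *.
by rewrite /= in E; rewrite E /= rxy.
Qed.

Lemma red_const x s : {in s, forall y, y = x} -> red (x :: s) = [:: x].
Proof.
elim: s x => [//|y s IH] x H.
have -> : y = x by apply: H; rewrite mem_head.
have := IH x; rewrite /= => ->; first exact: push_top.
by move=> z zs; apply: H; rewrite inE zs orbT.
Qed.

Lemma dd_const s x : dd s = [:: x] -> {in s, forall y, y = x}.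
Proof.
elim: s x => [//|y s IH] x /= E z; rewrite inE.
move: E; case Es: (dd s) => [|w s'] /=.
  by case: s Es {IH} => [_ [->]|a s Es]; [rewrite orbF => /eqP|
    have [s' E] := dd_cons a s; rewrite E in Es].
case: (eqVneq y w) => [->|_] // [Ew Es']; rewrite {}Ew {}Es' in Es *.
by case/orP => [/eqP|/IH]//; apply.
Qed.

Lemma red_cat_const z s t : {in s, forall y, y = z} ->
  red (z :: s ++ t) = red (z :: t).
Proof.
elim: s => [//|y s IH] H.
have Ey : y = z by apply: H; rewrite mem_head.
rewrite {}Ey in H *; have Hs : {in s, forall y, y = z}.
  by move=> w ws; apply: H; rewrite inE ws orbT.
rewrite -(IH Hs) -[RHS]/(push z (red (s ++ t))).
by rewrite -[LHS]/(push z (push z (red (s ++ t)))) pushK.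
Qed.

Lemma reduced_mkseq (g : nat -> X) m n :
  (forall i, g i != g i.+1) -> (forall i, g i != g i.+2) -> reduced (map g (iota m n)).
Proof.
move=> H1 H2; elim: n m => [//|n IH] m /=; rewrite IH andbT.
by case: n {IH} => [//|n] /=; rewrite H1 /=; case: n => //=.
Qed.

End Words.

Section MapWords.
Variables X Y : eqType.

Lemma dd_map_cons (h : X -> Y) x t :
  dd (map h (cons_dd x t)) = cons_dd (h x) (dd (map h t)).
Proof.
case: t => [//|y t] /=.
by case: (eqVneq x y) => [->|_] //=; rewrite cons_ddK.
Qed.

Lemma dd_map (h : X -> Y) s : dd (map h (dd s)) = dd (map h s).
Proof. by elim: s => //= x s IH; rewrite -/(dd s) dd_map_cons IH. Qed.

(* The merged word moves in both coordinates exactly when the common image moves. *)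
Lemma weave (Z : eqType) (f : X -> Z) (g : Y -> Z) (r : rel X) (q : rel Y) x p y s :
  path r x p -> path q y s ->
  dd (map f (x :: p)) = dd (map g (y :: s)) ->
  exists w : seq (X * Y),
  [/\ path (fun a b => [&& (a.1 == b.1) || r a.1 b.1, (a.2 == b.2) || q a.2 b.2,
                        f a.1 == g a.2, f b.1 == g b.2 &
                        (f a.1 == f b.1) ==> ((a.1 == b.1) || (a.2 == b.2))]) (x, y) w,
      dd (map fst ((x, y) :: w)) = dd (x :: p) &
      dd (map snd ((x, y) :: w)) = dd (y :: s)].
Proof.
have [n] := ubnP (size p + size s).
elim: n x p y s => // n IH x p y s; rewrite ltnS => Hn rp qs E.
have Exy : f x = g y.
  have [s1 E1] := dd_cons (f x) (map f p); have [s2 E2] := dd_cons (g y) (map g s).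
  by move: E; rewrite /= in E1 E2; rewrite /= E1 E2 => -[].
case: p rp E Hn => [|x' p] rp E Hn; case: s qs E Hn => [|y' s] qs E Hn.
- by exists [::].
- have Ey' : g y' = g y.
    apply: (dd_const (s := map g [:: y, y' & s])).
      by rewrite -E /= Exy.
    by rewrite /= !inE eqxx orbT.
  case/andP: qs => qyy' qs.
  have [|//|//||w [W1 W2 W3]] := IH x [::] y' s.
  - by move: Hn; rewrite /= addnS.
  - rewrite {}E /= Ey'; have [s' E'] := dd_cons (g y) (map g s).
    by rewrite /= in E'; rewrite E' /= eqxx.
  exists ((x, y') :: w); split => /=.
  + by rewrite !eqxx qyy' Exy Ey' W1 !eqxx orbT.
  + by rewrite -[X in cons_dd x X]/(dd (map fst ((x, y') :: w))) W2 /= eqxx.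
  + by rewrite -[X in cons_dd y X]/(dd (map snd ((x, y') :: w))) W3.
- have Ex' : f x' = f x.
    apply: (dd_const (s := map f [:: x, x' & p])).
      by rewrite E /= Exy.
    by rewrite /= !inE eqxx orbT.
  case/andP: rp => rxx' rp.
  have [|//|//||w [W1 W2 W3]] := IH x' p y [::].
  - by move: Hn; rewrite /= !addSn.
  - rewrite -{}E /= Ex'; have [s' E'] := dd_cons (f x) (map f p).
    by rewrite /= in E'; rewrite E' /= eqxx.
  exists ((x', y) :: w); split => /=.
  + by rewrite !eqxx rxx' Ex' Exy !eqxx W1 !orbT.
  + by rewrite -[X in cons_dd x X]/(dd (map fst ((x', y) :: w))) W2.
  + by rewrite -[X in cons_dd y X]/(dd (map snd ((x', y) :: w))) W3 /= eqxx.
- have /andP[rxx' rp'] := rp; have /andP[qyy' qs'] := qs.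
  have [s1 E1] := dd_cons (f x') (map f p); have [s2 E2] := dd_cons (g y') (map g s).
  (* A move invisible in the common image is made by one coordinate alone while the other waits.
     When both next moves are visible, they have the same image and are made together. *)
  case: (eqVneq (f x) (f x')) => [Ex'|nx].
    have [|//|//||w [W1 W2 W3]] := IH x' p y (y' :: s).
    + by move: Hn; rewrite /= !addSn !addnS.
    + rewrite -{}E /= in E1 *; rewrite E1 Ex' /= eqxx //.
    exists ((x', y) :: w); split => /=.
    * by rewrite !eqxx rxx' -Ex' Exy !eqxx W1 !orbT.
    * by rewrite -[X in cons_dd x X]/(dd (map fst ((x', y) :: w))) W2.
    * rewrite -[X in cons_dd y X]/(dd (map snd ((x', y) :: w))) W3 /=.
      by rewrite -/(cons_dd y _) cons_ddK.
  case: (eqVneq (g y) (g y')) => [Ey'|ny].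
    have [|//|//||w [W1 W2 W3]] := IH x (x' :: p) y' s.
    + by move: Hn; rewrite /= !addSn !addnS.
    + rewrite {}E /= in E2 *; rewrite E2 Ey' /= eqxx //.
    exists ((x, y') :: w); split => /=.
    * by rewrite !eqxx qyy' -Ey' Exy !eqxx W1 !orbT.
    * rewrite -[X in cons_dd x X]/(dd (map fst ((x, y') :: w))) W2 /=.
      by rewrite -/(cons_dd x _) cons_ddK.
    * by rewrite -[X in cons_dd y X]/(dd (map snd ((x, y') :: w))) W3.
  have E' : dd (map f (x' :: p)) = dd (map g (y' :: s)).
    move: E; rewrite /= in E1 E2 *; rewrite E1 E2 /= (negbTE nx) (negbTE ny).
    by case=> _ -> ->.
  have Exy' : f x' = g y' by move: E'; rewrite /= in E1 E2 *; rewrite E1 E2 => -[].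
  have [|//|//|//|w [W1 W2 W3]] := IH x' p y' s.
    by move: Hn; rewrite /= !addSn !addnS => /ltnW.
  exists ((x', y') :: w); split => /=.
  * by rewrite rxx' qyy' Exy Exy' !eqxx W1 !orbT -Exy -Exy' (negbTE nx).
  * by rewrite -[X in cons_dd x X]/(dd (map fst ((x', y') :: w))) W2.
  * by rewrite -[X in cons_dd y X]/(dd (map snd ((x', y') :: w))) W3.
Qed.

End MapWords.

(** * Perfect elimination towards a clique *)

Section ChordalGraphs.
Variables (V : finType) (e : rel V).
Implicit Types (A B K N S U W : {set V}) (u v w : V).

Definition nbh W v := [set u in W | e v u].

Lemma cliqueS A B : A \subset B -> clique e B -> clique e A.
Proof. by move=> /subsetP sAB cB u v /sAB uB /sAB; apply: cB. Qed.

Lemma cyc_adj_lt n (i j : 'I_n) : 3 <= n -> i < j ->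
  cyc_adj i j = (j == i.+1 :> nat) || ((i == 0 :> nat) && (j == n.-1 :> nat)).
Proof.
move=> n3 ltij; rewrite /cyc_adj /=.
have Hj := ltn_ord j.
rewrite (modn_small (m := i.+1)); last by lia.
have [Ej|nj] := eqVneq (nat_of_ord j) n.-1.
  have -> : j.+1 = n by lia.
  by rewrite modnn; lia.
by rewrite (modn_small (m := j.+1)); lia.
Qed.

Hypothesis (symE : symmetric e) (irrE : irreflexive e).

Lemma clique_nbhU1 W v : clique e (nbh W v) -> clique e (v |: nbh W v).
Proof.
move=> cN u u' /setU1P[->|uN] /setU1P[->|u'N] n; first by rewrite eqxx in n.
- by move: u'N; rewrite inE => /andP[].
- by move: uN; rewrite inE symE => /andP[].
exact: cN.
Qed.

Lemma cyc_adj_sym n : symmetric (@cyc_adj n).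
Proof. by move=> i j; rewrite /cyc_adj orbC. Qed.

Lemma cyc_adj_irr n (i : 'I_n) : 2 <= n -> cyc_adj i i = false.
Proof.
move=> n2; rewrite /cyc_adj orbb; apply/negbTE/eqP => /= H.
have Hi := ltn_ord i; have [E|ne] := eqVneq i.+1 n.
  by move: H; rewrite E modnn; lia.
by move: H; rewrite modn_small; lia.
Qed.

Hypothesis chE : chordal e.

Definition rel_in B := [rel x y | [&& e x y, x \in B & y \in B]].

(** A shortest path from [s] to [s'] through [B] has no chords. Were [s] and [s'] not adjacent, it
    would have an interior vertex, and closing it through [z] would give an induced cycle of length
    at least four. *)
Lemma chordal_neighbors_adj B s s' z :
  s \notin B -> s' \notin B -> s != s' ->
  connect (rel_in (s |: (s' |: B))) s s' ->
  z \notin B -> {in B, forall b, ~~ e z b} ->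
  e z s -> e z s' -> e s s'.
Proof.
move=> sB s'B nss' /connectP[p0 Hp0 Ep0] zB Hz zs zs'.
apply/negPn/negP => nadj.
set q := rel_in _ in Hp0 *.
have [p [Hp Ep Up Hmin]] : exists p, [/\ path q s p, last s p = s', uniq (s :: p) &
    forall p', path q s p' -> last s p' = s' -> size p <= size p'].
  have ex : exists n, [exists t : n.-tuple V, path q s t && (last s t == s')].
    by exists (size p0); apply/existsP; exists (in_tuple p0); rewrite /= Hp0 -Ep0 eqxx.
  case: (ex_minnP ex) => m /existsP[t /andP[Ht /eqP Et]] Hm.
  have Hm' p' : path q s p' -> last s p' = s' -> m <= size p'.
    move=> Hp' Ep'; apply: Hm; apply/existsP; exists (in_tuple p').
    by rewrite /= Hp' Ep' eqxx.
  case/shortenP: Ht Et => p' Hp' Up' sub Et.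
  exists p'; split => // p'' H1 H2; apply: leq_trans (Hm' _ H1 H2).
  by rewrite -(size_tuple t) uniq_leq_size //; case/andP: Up'.
set P := s :: p; set m := size p.
have qP i : i < m -> q (nth z P i) (nth z P i.+1).
  by move=> Hi; apply: (pathP z Hp).
have lastP : nth z P m = s' by rewrite /P /m nth_last /= Ep.
have inP i : i <= m -> nth z P i \in s |: (s' |: B).
  move=> Hi; case: i Hi => [_|i Hi]; first by rewrite /= !inE eqxx.
  by have /and3P[] := qP i Hi.
have inB i : 0 < i < m -> nth z P i \in B.
  move=> /andP[i0 im]; have := inP i (ltnW im); rewrite !inE.
  have nu i' j' : i' <= m -> j' <= m -> (nth z P i' == nth z P j') = (i' == j').
    by move=> H1 H2; rewrite nth_uniq.
  rewrite -{1}lastP -[X in _ == X]/(nth z P 0) !nu // ?(ltnW im) //.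
  by rewrite gtn_eqF // ltn_eqF.
have chord i j : i < j -> j <= m -> e (nth z P i) (nth z P j) = (j == i.+1).
  move=> ij jm; case: eqP => [->|nij].
    by have /and3P[] := qP i (leq_trans ij jm).
  (* A chord would replace the stretch from position [i] to position [j] by one edge, against the
     minimality of [p]. *)
  apply/negP => eij; have ltij : i.+1 < j by rewrite ltn_neqAle eq_sym ij andbT; apply/eqP.
  have lm : i <= m := ltnW (leq_trans ij jm).
  have Htake : path q s (take i p) /\ last s (take i p) = nth z P i.
    split; first exact: take_path.
    have := nth_last s (s :: take i p); rewrite /= size_takel //.
    rewrite -/(nth s (s :: take i p) i) => <-.
    by case: (i) lm => [//|i'] lm; rewrite /= nth_take // (set_nth_default z).
  have Hdrop : path q (nth z P j) (drop j p) /\ last (nth z P j) (drop j p) = s'.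
    case: j ij jm eij nij ltij => // j _ jm _ _ _; rewrite /P /=.
    have := Hp; rewrite -{1}(cat_take_drop j p) cat_path (drop_nth z) //= => /and3P[_ _ ->].
    split=> //; have := Ep; rewrite -{1}(cat_take_drop j p) last_cat (drop_nth z) //.
  have := Hmin (take i p ++ nth z P j :: drop j p).
  rewrite cat_path last_cat /= Htake.1 Htake.2 Hdrop.1 Hdrop.2 eij !inP // => /(_ isT erefl).
  rewrite size_cat /= size_takel // size_drop -/m => Hm.
  by clearbody m; clear -Hm ltij jm; lia.
pose C := z :: P.
have zP i : 0 < i < m -> e z (nth z P i) = false.
  by move=> /inB /Hz /negbTE.
have sizeP : size P = m.+1 by [].
have m2 : 2 <= m.
  rewrite ltnNge; apply/negP; case: (m) lastP chord inP => [|[|//]] lastP chord inP _.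
    by move: nss'; rewrite -lastP eqxx.
  by move: nadj; rewrite -lastP (chord 0 1).
have zs0 : z != s by apply: contraTneq zs => ->; rewrite irrE.
have zs0' : z != s' by apply: contraTneq zs' => ->; rewrite irrE.
have zinP : z \notin P.
  apply/negP => /(nthP z)[i]; rewrite sizeP ltnS => Hi Ei.
  have := inP i Hi; rewrite Ei !inE.
  by rewrite (negbTE zs0) (negbTE zs0') (negbTE zB).
have chordC i j : i < j -> j < m.+2 ->
    e (nth z C i) (nth z C j) = (j == i.+1) || ((i == 0) && (j == m.+1)).
  case: j => // j; case: i => [|i] /=; last first.
    by rewrite !ltnS eqSS orbF; apply: chord.
  move=> _; rewrite ltnS => Hj; rewrite !eqSS.
  case: (posnP j) => [->|j0]; first by rewrite zs.
  case: (eqVneq j m) => [->|nj]; first by rewrite lastP zs' orbT.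
  by rewrite zP ?orbF ?gtn_eqF // j0 ltn_neqAle nj -ltnS.
have n4 : 3 < m.+2 by [].
pose c (i : 'I_m.+2) := nth z C i.
apply: (chE n4 (c := c)).
  move=> i j /eqP; rewrite nth_uniq // ?ltn_ord //=; last by rewrite zinP.
  by move/eqP/val_inj.
have lt_case (i j : 'I_m.+2) : i < j -> e (c i) (c j) = cyc_adj i j.
  by move=> ij; rewrite (cyc_adj_lt (ltnW n4) ij) -chordC.
move=> i j; case: (ltngtP i j) => [|ji|/val_inj->]; first exact: lt_case.
  by rewrite symE cyc_adj_sym lt_case.
by rewrite irrE cyc_adj_irr.
Qed.
Lemma rel_in_sym B : symmetric (rel_in B).
Proof. by move=> x y; rewrite /= symE; case: (e y x) => //=; rewrite andbC. Qed.

Lemma connect_rel_inS B B' x y : B \subset B' ->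
  connect (rel_in B) x y -> connect (rel_in B') x y.
Proof.
move=> /subsetP sB; apply: connect_sub => u v /and3P[euv uB vB].
by apply: connect1; rewrite /= euv !sB.
Qed.

(* Take a maximal connected set [B] around [a] that does not dominate [W], and let [R]
   be the set of vertices that it leaves undominated. Maximality makes every neighbor
   of [B] adjacent to all of [R], and then chordality makes these neighbors a clique;
   so a simplicial vertex of [R] is simplicial in [W]. *)
Lemma simplicial_far n W a :
  (forall W', #|W'| < n -> W' != set0 -> exists2 v, v \in W' & clique e (nbh W' v)) ->
  #|W| <= n -> a \in W -> (exists2 w, w \in W & (w != a) && ~~ e a w) ->
  exists2 v, v \in W & [/\ v != a, ~~ e a v & clique e (nbh W v)].
Proof.
move=> IH Wn aW [w0 w0W /andP[nw0 aw0]].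
pose undom B := [set r in W :\: B | [forall b in B, ~~ e r b]].
pose P B := [&& a \in B, B \subset W, [forall b in B, connect (rel_in B) a b] &
             undom B != set0].
have Pa : P [set a].
  rewrite /P set11 sub1set aW /=; apply/andP; split.
    by apply/forall_inP => b /set1P->.
  apply/set0Pn; exists w0; rewrite !inE nw0 w0W /=.
  by apply/forall_inP => b /set1P->; rewrite symE.
have [B /maxsetP[/and4P[aB sBW /forall_inP conB ndB] maxB] _] := maxset_exists Pa.
have undomP r : r \in undom B -> [/\ r \in W, r \notin B & {in B, forall b, ~~ e r b}].
  by rewrite !inE => /andP[/andP[-> ->] /forall_inP].
have adjR s b r : s \in W -> s \notin B -> b \in B -> e s b -> r \in undom B -> e s r.
  move=> sW sB bB sb /undomP[rW rB Hr]; apply/negPn/negP => nsr.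
  (* Otherwise [r] stays undominated when [s] joins [B], and [s |: B] is a larger set satisfying
     [P]. *)
  suff /maxB E : P (s |: B) by move: sB; rewrite -(E (subsetUr _ _)) setU11.
  rewrite /P !inE aB orbT subUset sub1set sW sBW /=; apply/andP; split.
    apply/forall_inP => b'; have sBs : B \subset s |: B by rewrite subsetUr.
    have cB b2 : b2 \in B -> connect (rel_in (s |: B)) a b2.
      by move=> /conB; apply: connect_rel_inS.
    case/setU1P => [->|/cB//]; apply: connect_trans (cB _ bB) (connect1 _).
    by rewrite /= symE sb setU11 inE bB orbT.
  apply/set0Pn; exists r; rewrite !inE negb_or rB rW andbT /=.
  have -> : r != s by apply: contraTneq sb => <-; apply: Hr.
  apply/forall_inP => b' /setU1P[->|/Hr//]; by rewrite symE.
have [|v vR cv] := IH (undom B) _ ndB.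
  apply: leq_trans Wn; apply: proper_card; apply/properP; split.
    by apply/subsetP => r /undomP[].
  by exists a => //; apply/negP => /undomP[]; rewrite aB.
have [vW vB Hv] := undomP v vR.
exists v => //; split; first by apply: contraNneq vB => ->.
  by rewrite symE Hv.
have nbhP u : u \in nbh W v ->
    [/\ u \in W, e v u, u \notin B & u \in undom B \/ exists2 b, b \in B & e u b].
  rewrite inE => /andP[uW vu]; have uB : u \notin B.
    by apply/negP => /Hv; rewrite vu.
  split=> //; case: (boolP (u \in undom B)) => [|nu]; first by left.
  right; move: nu; rewrite !inE uB uW /= negb_forall => /existsP[b].
  by rewrite negb_imply negbK => /andP[]; exists b.
move=> u1 u2 /nbhP[W1 e1 B1 H1] /nbhP[W2 e2 B2 H2] n12.
case: H1 => [R1|[b1 b1B ub1]]; case: H2 => [R2|[b2 b2B ub2]].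
- by apply: cv => //; rewrite inE ?R1 ?R2.
- by rewrite symE (adjR u2 b2).
- by rewrite (adjR u1 b1).
apply: (@chordal_neighbors_adj B u1 u2 v) => //.
set B' := _ |: _; have sB : B \subset B' by rewrite /B' setUA subsetUr.
have cs := connect_rel_inS sB.
have in1 b : b \in B -> e u1 b -> connect (rel_in B') u1 b.
  by move=> bB ub; apply: connect1; rewrite /= ub !inE bB eqxx !orbT.
have in2 b : b \in B -> e u2 b -> connect (rel_in B') b u2.
  by move=> bB ub; apply: connect1; rewrite /= symE ub !inE bB eqxx !orbT.
apply: connect_trans (in1 _ b1B ub1) _; apply: connect_trans (in2 _ b2B ub2).
apply: cs; rewrite (@connect_trans _ _ a) ?conB //.
by rewrite (sym_connect_sym (@rel_in_sym B)) conB.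
Qed.

(** Dirac's simplicial vertex, kept away from a clique. If some vertex of [A] misses another vertex
    of [W], [simplicial_far] gives a simplicial vertex not adjacent to it, hence outside [A].
    Otherwise [A] is joined to everything, and a simplicial vertex of [W :\: A] stays simplicial in
    [W]. *)
Lemma simplicial_outside_clique W A : clique e A -> A \proper W ->
  exists2 v, v \in W :\: A & clique e (nbh W v).
Proof.
have [n] := ubnP #|W|; elim: n W A => // n IH W A; rewrite ltnS => Wn.
wlog A0 : A / A != set0.
  move=> wl cA pA; have [A0|] := eqVneq A set0; last by move=> /wl; apply.
  have /set0Pn[a aW] : W != set0 by rewrite -proper0 -A0.
  have [EW|nW] := eqVneq W [set a].
    exists a; first by rewrite EW A0 setD0 set11.
    move=> u v; rewrite EW !inE => /andP[/eqP-> _] /andP[/eqP-> _].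
    by rewrite eqxx.
  have [|||v] := wl [set a].
  - by apply/set0Pn; exists a; rewrite set11.
  - by move=> u v /set1P-> /set1P->; rewrite eqxx.
  - by rewrite properEneq eq_sym nW sub1set.
  - by rewrite inE => /andP[_ vW]; exists v => //; rewrite A0 setD0.
move=> cA /properP[/subsetP sAW [w wW wA]].
have IH' W' : #|W'| < n -> W' != set0 -> exists2 v, v \in W' & clique e (nbh W' v).
  move=> W'n W'0; have [||v] := IH W' set0 W'n; last by rewrite setD0; exists v.
    by move=> u v; rewrite inE.
  by rewrite proper0.
have [/exists_inP[a aA /exists_inP[x xW Hx]]|all] :=
    boolP [exists a in A, [exists x in W, (x != a) && ~~ e a x]].
  have [|v vW [va av cv]] := simplicial_far IH' Wn (sAW a aA); first by exists x.
  exists v => //; rewrite inE vW andbT; apply: contraNN av => vA.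
  by apply: cA; rewrite // eq_sym.
have univ a x : a \in A -> x \in W -> x != a -> e a x.
  move=> aA xW xa; apply: contraNT all => nax.
  by apply/exists_inP; exists a => //; apply/exists_inP; exists x; rewrite // xa.
have [||v vWA cv] := IH' (W :\: A).
- apply: leq_trans Wn; apply: proper_card; have /set0Pn[a aA] := A0.
  by apply/properP; split; [rewrite subsetDl | exists a; rewrite ?sAW // inE aA].
- by apply/set0Pn; exists w; rewrite inE wA.
exists v => // u1 u2; rewrite !inE => /andP[W1 e1] /andP[W2 e2] n12.
have [A1|A1] := boolP (u1 \in A); first by apply: univ; rewrite // eq_sym.
have [A2|A2] := boolP (u2 \in A); first by rewrite symE; apply: univ.
by apply: cv; rewrite // !inE ?A1 ?A2 ?W1 ?W2.
Qed.

(** Connectedness of the induced subgraph in cut form; the empty set qualifies. *)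
Definition indecomp U :=
  forall X : {set V}, X \subset U -> X != set0 -> X != U ->
  exists x y, [/\ x \in X, y \in U :\: X & e x y].

(** Connections through a simplicial vertex can be short-circuited: if an edge leaves [X] towards
    [v] and another leaves [v |: X] from [v], their other ends are neighbors of [v] and hence
    adjacent. *)
Lemma indecompD1 U v : clique e (nbh U v) -> indecomp U -> indecomp (U :\ v).
Proof.
move=> cv iU X sX X0 nX.
have [vU|vU] := boolP (v \in U); last first.
  have EU : U :\ v = U by apply/setDidPl; rewrite disjoint_sym disjoints1.
  by rewrite EU in sX nX *; apply: iU.
have sXU := subset_trans sX (subsetDl U [set v]).
have vX : v \notin X by apply/negP => /(subsetP sX); rewrite !inE eqxx.
have [y0 y0U y0X] : exists2 y, y \in U :\ v & y \notin X.
  by move: nX; rewrite eqEsubset sX /= => /subsetPn.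
have [|x [y [xX yUX xy]]] := iU X sXU X0; first by apply: contraNneq vX => ->.
move: yUX; rewrite inE => /andP[yX yU].
have [Ey|nyv] := eqVneq y v; last by exists x, y; rewrite !inE xX yX nyv yU.
rewrite {}Ey in xy yX yU.
have [|||x' [y' [x'X y'UX xy']]] := iU (v |: X).
- by rewrite subUset sub1set vU.
- by apply/set0Pn; exists v; rewrite setU11.
- apply: contraTneq y0U => E; rewrite !inE -E !inE (negbTE y0X) orbF.
  by case: (y0 == v).
move: y'UX; rewrite !inE negb_or -andbA => /and3P[y'v y'X y'U].
case/setU1P: x'X => [Ex'|x'X]; last by exists x', y'; rewrite !inE x'X y'X y'v y'U.
exists x, y'; rewrite !inE xX y'X y'v y'U; split=> //; apply: cv.
- by rewrite inE (subsetP sXU) // symE.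
- by rewrite inE y'U -Ex'.
- by apply: contraNneq y'X => <-.
Qed.

Lemma l_connected_indecomp l S : l_connected l e -> #|S| < l -> indecomp (~: S).
Proof.
move=> [_ cut] Sl X sX /set0Pn[x xX] nX.
have [/existsP[x' /existsP[y /and3P[]]]|no] :=
    boolP [exists x, [exists y, [&& x \in X, y \in ~: S :\: X & e x y]]].
  by exists x', y.
have [y yS yX] : exists2 y, y \in ~: S & y \notin X.
  by move: nX; rewrite eqEsubset sX /= => /subsetPn.
suff : l <= #|S| by rewrite leqNgt Sl.
apply: cut; exists x, y; split.
- by have := subsetP sX _ xX; rewrite inE.
- by move: yS; rewrite inE.
apply: contraNN yX => cxy.
suff cl : closed (del_rel e S) X by rewrite -(closed_connect cl cxy).
apply: intro_closed; first apply: sym_connect_sym => u w.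
  by rewrite /del_rel /= symE [(u \notin S) && _]andbC.
move=> u w /and3P[euw uS wS] uX; apply: contraNT no => wX.
apply/existsP; exists u; apply/existsP; exists w.
by rewrite uX euw !inE wX wS.
Qed.

(** Read backwards, simplicial vertices outside [A] are peeled off one by one. The invariant is that
    deleting fewer than [k - 2] vertices leaves [W] connected; it bounds the degree of each peeled
    vertex from below. *)
Lemma clique_ind k A (Phi : {set V} -> Prop) :
  l_connected (k - 2) e -> clique e A -> k - 2 <= #|A| -> Phi A ->
  (forall W v, A \subset W -> v \notin W -> clique e (nbh W v) -> k - 2 <= #|nbh W v| ->
     Phi W -> Phi (v |: W)) ->
  Phi setT.
Proof.
move=> lc cA kA PA step.
suff H W : A \subset W -> (forall S, #|S| < k - 2 -> indecomp (W :\: S)) -> Phi W.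
  by apply: H => [|S HS]; [exact: subsetT | rewrite setTD; apply: l_connected_indecomp HS].
have [n] := ubnP #|W|; elim: n W => // n IH W; rewrite ltnS => Wn sAW iW.
have [<-//|nAW] := eqVneq A W.
have pAW : A \proper W by rewrite properEneq nAW.
have [v vWA cv] := simplicial_outside_clique cA pAW.
move: vWA; rewrite inE => /andP[vA vW].
have nbhD : nbh (W :\ v) v = nbh W v.
  by apply/setP => u; rewrite !inE; case: (eqVneq u v) => [->|//]; rewrite irrE !andbF.
have dv : k - 2 <= #|nbh W v|.
  rewrite leqNgt; apply/negP => Hd.
  (* Deleting the too small neighborhood would isolate [v]. Nor can [v] be all that remains, since
     then [#|W| <= k - 2 <= #|A| < #|W|]. *)
  have [|||x [y [/set1P-> ]]] := iW _ Hd [set v].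
  - by rewrite sub1set !inE irrE andbF vW.
  - by apply/set0Pn; exists v; rewrite set11.
  - apply/eqP => E; have := proper_card pAW.
    rewrite ltnNge (leq_trans _ kA) // (leq_trans _ Hd) //.
    have : #|W| <= #|v |: nbh W v|.
      apply: subset_leq_card; apply/subsetP => u uW; rewrite in_setU1.
      have [//|Hu] := boolP (u \in nbh W v); first by rewrite orbT.
      have : u \in W :\: nbh W v by rewrite inE Hu.
      by rewrite -E => /set1P->; rewrite eqxx.
    move=> H; apply: leq_trans H _.
    by rewrite cardsU1 -add1n leq_add2r leq_b1.
  by rewrite !inE => /and3P[_ nyW yW]; rewrite yW /= in nyW; move=> vy; rewrite vy in nyW.
rewrite -(setD1K vW); apply: step.
- by rewrite subsetD1 sAW.
- by rewrite !inE eqxx.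
- by rewrite nbhD.
- by rewrite nbhD.
apply: IH.
- by apply: leq_trans Wn; rewrite [in X in _ < X](cardsD1 v) vW.
- by rewrite subsetD1 sAW.
move=> S HS; have -> : W :\ v :\: S = (W :\: S) :\ v by rewrite !setDDl setUC.
apply: indecompD1; last exact: iW.
by apply: cliqueS cv; apply/subsetP => u; rewrite !inE -andbA => /and3P[_ -> ->].
Qed.

End ChordalGraphs.

(** * Paths of partial colorings *)

Section PartialColorings.
Variables (k : nat) (V : finType) (e : rel V).
Hypotheses (symE : symmetric e) (irrE : irreflexive e).
Local Notation L := {ffun V -> option 'I_k}.
Implicit Types (x y z : L) (p : seq L) (A K N W : {set V}) (u v : V).

Definition res K x : L := [ffun u => if u \in K then x u else None].

Definition isC W x : bool :=
  [forall u, (x u != None) == (u \in W)] &&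
  [forall u in W, forall v in W, e u v ==> (x u != x v)].

(** Standing still counts as a step, so that a step survives restriction to a set missing the
    recolored vertex. *)
Definition step W : rel L := [rel x y | [&& isC W x, isC W y &
  [forall u, forall v, (x u != y u) ==> (x v != y v) ==> (u == v)]]].

Lemma isCP W x : reflect
  ((forall u, (x u != None) = (u \in W)) /\ {in W &, forall u v, e u v -> x u != x v})
  (isC W x).
Proof.
apply: (iffP andP) => -[H1 H2]; split.
- by move=> u; have /forallP/(_ u)/eqP := H1.
- move=> u v uW vW; apply/implyP.
  by have /forall_inP := forall_inP H2 u uW; apply.
- by apply/forallP => u; apply/eqP.
- by apply/forall_inP => u uW; apply/forall_inP => v vW; apply/implyP/H2.
Qed.

Lemma stepP W x y : reflect
  [/\ isC W x, isC W y & forall u v, x u != y u -> x v != y v -> u = v] (step W x y).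
Proof.
apply: (iffP and3P) => -[Hx Hy H]; split=> //.
  by move=> u v xu xv; move/forallP/(_ u)/forallP/(_ v): H; rewrite xu xv => /eqP.
apply/forallP => u; apply/forallP => v; apply/implyP => xu; apply/implyP => xv.
exact/eqP/H.
Qed.

Lemma step_isCl W x y : step W x y -> isC W x.
Proof. by case/stepP. Qed.

Lemma step_isCr W x y : step W x y -> isC W y.
Proof. by case/stepP. Qed.

Lemma isC_out W x u : isC W x -> u \notin W -> x u = None.
Proof. by move=> /isCP[H _] uW; apply/eqP; rewrite -[_ == _]negbK H. Qed.

Lemma resK A K x : A \subset K -> res A (res K x) = res A x.
Proof.
move=> /subsetP sAK; apply/ffunP => u; rewrite !ffunE.
by case: (boolP (u \in A)) => // /sAK ->.
Qed.

Lemma res_id W x : isC W x -> res W x = x.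
Proof.
move=> Hx; apply/ffunP => u; rewrite ffunE.
by case: (boolP (u \in W)) => // /(isC_out Hx) ->.
Qed.

Lemma res_eqP A x y : reflect {in A, x =1 y} (res A x == res A y).
Proof.
apply: (iffP eqP) => [H u uA|H].
  by have := congr1 (fun f : L => f u) H; rewrite !ffunE uA.
by apply/ffunP => u; rewrite !ffunE; case: (boolP (u \in A)) => // /H.
Qed.

Lemma isC_res K W x : K \subset W -> isC W x -> isC K (res K x).
Proof.
move=> /subsetP sKW /isCP[H1 H2]; apply/isCP; split=> [u|u v uK vK euv].
  by rewrite ffunE; case: (boolP (u \in K)) => // /sKW; rewrite H1.
by rewrite !ffunE uK vK H2 ?sKW.
Qed.

Lemma step_res K W x y : K \subset W -> step W x y -> step K (res K x) (res K y).
Proof.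
move=> sKW /stepP[Hx Hy H]; apply/stepP; split; try exact: isC_res sKW _.
move=> u v; rewrite !ffunE; case: ifP => // _; case: ifP => // _; exact: H.
Qed.

Lemma path_res K W x p : K \subset W -> path (step W) x p ->
  path (step K) (res K x) (map (res K) p).
Proof. by move=> sKW; apply: homo_path => a b; apply: step_res. Qed.

(** Pigeonhole: the clique shows [#|A|] distinct colors, and [cs] lists further ones. *)
Lemma card_clique_colors A x (cs : seq (option 'I_k)) :
  clique e A -> isC A x -> uniq cs ->
  {in cs, forall c, c != None /\ {in A, forall u, x u != c}} ->
  #|A| + size cs <= k.
Proof.
move=> cA /isCP[H1 H2] Ucs Hcs.
have <- : #|[set x u | u in A]| = #|A|.
  apply: card_in_imset => u v uA vA Exy; apply/eqP/negPn/negP => nuv.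
  by have := H2 u v uA vA (cA _ _ uA vA nuv); rewrite Exy eqxx.
have <- : #|[set c in cs]| = size cs by rewrite cardsE; apply/card_uniqP.
have dis : [disjoint [set x u | u in A] & [set c in cs]].
  rewrite -setI_eq0; apply/eqP/setP => c; rewrite !inE; apply/negP => /andP[].
  by case/imsetP => u uA -> /Hcs[_ /(_ u uA)]; rewrite eqxx.
have Ek : #|[set~ (None : option 'I_k)]| = k by rewrite cardsC1 card_option card_ord.
have [_] := leq_card_setU [set x u | u in A] [set c in cs].
rewrite dis => /eqP <-; rewrite -[leqRHS]Ek; apply: subset_leq_card; apply/subsetP => c.
rewrite !inE => /orP[/imsetP[u uA ->]|/Hcs[]//]; by rewrite H1.
Qed.

Lemma step_unmoved A v x y : v \notin A -> step (v |: A) x y -> res A x != res A y -> x v = y v.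
Proof.
move=> vA /stepP[_ _ H] nr; apply/eqP/negPn/negP => nv.
move: nr => /res_eqP []; move=> u uA; apply/eqP/negPn/negP => nu.
by move: vA; rewrite -(H u v nu nv) uA.
Qed.

Lemma isC_ext A v x y : isC (v |: A) x -> isC (v |: A) y ->
  res A x = res A y -> x v = y v -> x = y.
Proof.
move=> Hx Hy /eqP/res_eqP HA Hv; apply/ffunP => u.
have [/setU1P[->//|/HA//]|nu] := boolP (u \in v |: A).
by rewrite (isC_out Hx nu) (isC_out Hy nu).
Qed.

Lemma isC_neq A v x : v \notin A -> clique e (v |: A) -> isC (v |: A) x ->
  x v != None /\ {in A, forall u, x u != x v}.
Proof.
move=> vA cK /isCP[H1 H2]; split=> [|u uA]; first by rewrite H1 setU11.
have nuv : u != v by apply: contraNneq vA => <-.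
by apply: H2; [exact: setU1r|exact: setU11|apply: cK; rewrite ?setU11 ?setU1r].
Qed.

(* Over a coloring of a clique on [k - 2] vertices an extra vertex has only two
   available colors. *)
Lemma third_extension A v x y z : v \notin A -> clique e (v |: A) -> k - 2 <= #|A| -> 2 <= k ->
  isC (v |: A) x -> isC (v |: A) y -> isC (v |: A) z ->
  res A x = res A y -> res A y = res A z -> x != y -> y != z -> x != z -> False.
Proof.
move=> vA cK kA k2 Hx Hy Hz Exy Eyz nxy nyz nxz.
have dx (a b : L) : isC (v |: A) a -> isC (v |: A) b -> res A a = res A b -> a != b -> a v != b v.
  by move=> Ha Hb Eab; apply: contraNneq => Ev; apply/eqP; apply: isC_ext Ha Hb Eab Ev.
have /eqP/res_eqP rxy := Exy; have /eqP/res_eqP ryz := Eyz.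
have := @card_clique_colors A (res A x) [:: x v; y v; z v].
have [Nx Ix] := isC_neq vA cK Hx; have [Ny Iy] := isC_neq vA cK Hy.
have [Nz Iz] := isC_neq vA cK Hz.
move=> H; suff C : #|A| + 3 <= k by move: kA k2 C; clear; lia.
apply: H.
- by apply: cliqueS cK; apply: subsetUr.
- by apply: isC_res Hx; apply: subsetUr.
- by rewrite /= !inE negb_or !dx // Exy.
move=> c; rewrite !inE => /or3P[]/eqP->; split=> // u uA; rewrite ffunE uA.
- exact: Ix.
- by rewrite rxy // Iy.
- by rewrite rxy // ryz // Iz.
Qed.

(** Forgetting [v] must neither lose nor create a cancellation. The danger is that a backtrack on
    [A] appears once a flip of [v] in its middle is erased; counting colors excludes this. *)
Lemma push_contract A v x p : v \notin A -> clique e (v |: A) -> k - 2 <= #|A| -> 2 <= k ->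
  reduced p -> path (step (v |: A)) x p ->
  dd (map (res A) (push x p)) = push (res A x) (dd (map (res A) p)).
Proof.
move=> vA cK kA k2.
case: p => [//|y p]; have [t Et] := dd_cons (res A y) (map (res A) p).
have [-> _ _|nxy] := eqVneq x y; first by rewrite push_top [map _ _]/= Et push_top.
case: p t Et => [|z p] t Et.
  move=> _ _; rewrite /= (negbTE nxy) /=; by case: (res A x == res A y).
rewrite /= in Et.
have [<- _ _|nxz] := eqVneq x z.
  rewrite /= (negbTE nxy) eqxx /=.
  have [t' /= ->] := dd_cons (res A x) (map (res A) p); rewrite /=.
  case: (eqVneq (res A y) (res A x)) => [_|n] /=; first by rewrite eqxx.
  by rewrite eq_sym (negbTE n) eqxx.
rewrite [push x _]/= (negbTE nxy) (negbTE nxz).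
move=> /= /and3P[/andP[nyz Hp] Hz rp] /and3P[sxy syz Hpath].
rewrite Et /=.
case: (eqVneq (res A x) (res A y)) => [//|rxy].
case: t Et => [//|w t] Et; rewrite ifN_eq //.
have Hx := step_isCl sxy; have Hy := step_isCl syz; have Hz' := step_isCr syz.
have xvy := step_unmoved vA sxy rxy.
have [t' Et'] := dd_cons (res A z) (map (res A) p); rewrite /= in Et'.
rewrite Et' /= in Et.
case: (eqVneq (res A y) (res A z)) Et => [ryz|ryz] [].
  (* Here [v] flips between [y] and [z]. A second flip right after it is impossible by
     [third_extension], so the step to [z2] recolors [A]. *)
  move=> Et1 Et2; rewrite {}Et2 {Et1} in Et'.
  case: p Hp Hz rp Hpath Et' => [|z2 p] /=; first by move=> _ _ _ _ [].
  move=> nyz2 /andP[nzz2 _] _ /andP[szz2 _].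
  have [t2 /= ->] := dd_cons (res A z2) (map (res A) p); rewrite /=.
  have Hz2 := step_isCr szz2.
  case: (eqVneq (res A z) (res A z2)) => [rzz2 _|rzz2 [<- _]].
    by case: (third_extension vA cK kA k2 Hy Hz' Hz2 ryz rzz2 nyz nzz2 nyz2).
  apply/eqP => rxz2; have zvz2 := step_unmoved vA szz2 rzz2.
  have /existsP[s /andP[sA nxs]] : [exists s, (s \in A) && (x s != y s)].
    apply: contraNT rxy => /existsPn H; apply/res_eqP => s sA; apply/eqP.
    by have := H s; rewrite sA negbK.
  have /eqP/res_eqP rxz2' := rxz2; have /eqP/res_eqP ryz' := ryz.
  have [Nx Ix] := isC_neq vA cK Hx; have [Ny Iy] := isC_neq vA cK Hy.
  have [Nz Iz] := isC_neq vA cK Hz'; have [Nz2 Iz2] := isC_neq vA cK Hz2.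
  suff C : #|A| + 3 <= k by move: kA k2 C; clear; lia.
  apply: (@card_clique_colors A (res A y) [:: y v; z v; x s]).
  - by apply: cliqueS cK; apply: subsetUr.
  - by apply: isC_res Hy; apply: subsetUr.
  - rewrite /= !inE negb_or andbT.
    have -> : y v != z v by apply: contraNneq nyz => Ev; apply/eqP; apply: isC_ext Hy Hz' ryz Ev.
    by rewrite -xvy eq_sym Ix // zvz2 rxz2' // eq_sym Iz2.
  move=> c; rewrite !inE => /or3P[]/eqP->.
  - by split=> // u uA; rewrite ffunE uA Iy.
  - by split=> // u uA; rewrite ffunE uA ryz' // Iz.
  split=> [|u uA]; first by have /isCP[-> _] := Hx; rewrite setU1r.
  rewrite ffunE uA.
  have [->|nus] := eqVneq u s; first by rewrite eq_sym.
  have /stepP[_ _ Hd] := sxy.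
  have -> : y u = x u.
    by apply/eqP/negPn/negP; rewrite eq_sym => nu; case/eqP: nus; apply: Hd.
  by have /isCP[_ H] := Hx; apply: H; rewrite ?setU1r //; apply: cK; rewrite ?setU1r.
(* Both steps recolor [A], so [v] keeps its color, and a backtrack on [A] would already be one on
   [v |: A]. *)
move=> <- _; apply: contraNneq nxz => rxz; apply/eqP; apply: isC_ext Hx Hz' rxz _.
by rewrite xvy (step_unmoved vA syz ryz).
Qed.

Lemma red_contract1 A v x p : v \notin A -> clique e (v |: A) -> k - 2 <= #|A| -> 2 <= k ->
  path (step (v |: A)) x p ->
  dd (map (res A) (red (x :: p))) = red (map (res A) (x :: p)).
Proof.
move=> vA cK kA k2; elim: p x => [//|y p IH] x pxp.
have /andP[sxy pyp] := pxp; rewrite [red (x :: _)]/= -/(red (y :: p)).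
rewrite (push_contract vA cK kA k2 (reduced_red (y :: p))) ?IH //.
have := path_red pyp; have [t ->] := red_cons y p; move=> Hp; exact/andP.
Qed.

Lemma map_res_id K x p : isC K x -> path (step K) x p -> map (res K) (x :: p) = x :: p.
Proof.
elim: p x => [|y p IH] x Hx /=; first by rewrite res_id.
by move=> /andP[sxy /IH <-]; rewrite ?(step_isCr sxy) // res_id.
Qed.

Lemma dd_reduced (s : seq L) : reduced s -> dd s = s.
Proof.
elim: s => [//|x s IH] /= /andP[Hx /IH ->].
by case: s Hx {IH} => [//|y s] /= /andP[/negbTE -> _].
Qed.

(** The vertices of [K :\: A] are forgotten one at a time; each smaller clique still contains [A]
    and so has at least [k - 2] vertices. *)
Lemma red_contract A K x p : A \subset K -> clique e K -> k - 2 <= #|A| -> 2 <= k ->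
  isC K x -> path (step K) x p ->
  dd (map (res A) (red (x :: p))) = red (map (res A) (x :: p)).
Proof.
move=> sAK + kA k2; have [n] := ubnP #|K :\: A|.
elim: n K sAK x p => // n IH K sAK x p; rewrite ltnS => Kn cK Hx pxp.
have [EA|nAK] := eqVneq A K.
  rewrite {}EA; have [t Et] := red_cons x p.
  rewrite [map _ (x :: p)]map_res_id // Et map_res_id ?dd_reduced -?Et ?reduced_red //.
  by have := path_red pxp; rewrite Et.
have /properP[_ [u uK uA]] : A \proper K by rewrite properEneq nAK.
have EK : u |: (K :\ u) = K by rewrite setD1K.
have sK1 : K :\ u \subset K by rewrite subsetDl.
have sA1 : A \subset K :\ u by rewrite subsetD1 sAK.
have E1 : dd (map (res (K :\ u)) (red (x :: p))) = red (map (res (K :\ u)) (x :: p)).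
  apply: (red_contract1 (v := u)); rewrite ?EK // ?inE ?eqxx //.
  exact: leq_trans kA (subset_leq_card sA1).
have mapA s : map (res A) s = map (res A) (map (res (K :\ u)) s).
  by rewrite -map_comp; apply: eq_map => z /=; rewrite resK.
rewrite mapA -dd_map E1 [map (res A) (x :: p)]mapA.
apply: (IH (K :\ u)) => //; try exact: cliqueS cK.
- apply: leq_trans Kn; rewrite [in X in _ < X](cardsD1 u) !inE uA uK /=.
  by rewrite ltnS; apply: subset_leq_card; apply/subsetP => z; rewrite !inE => /and3P[-> -> ->].
- exact: isC_res Hx.
exact: path_res pxp.
Qed.

Lemma red_res_contract x p : 2 <= k -> isC setT x -> path (step setT) x p ->
  forall A K, A \subset K -> clique e K -> k - 2 <= #|A| ->
  dd (map (res A) (red (map (res K) (x :: p)))) = red (map (res A) (x :: p)).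
Proof.
move=> k2 Hx Hp A K sAK cK kA.
have -> : map (res A) (x :: p) = map (res A) (map (res K) (x :: p)).
  by rewrite -map_comp; apply: eq_map => z /=; rewrite resK.
apply: (red_contract sAK cK kA k2); first exact: isC_res Hx.
exact: path_res Hp.
Qed.

(** * Adding one vertex to paths of partial colorings *)

Definition paint v (o : option 'I_k) x : L := [ffun u => if u == v then o else x u].

Definition extend v (a : L * L) : L := paint v (a.2 v) a.1.

Section Extend.
Variables (W : {set V}) (v : V).
Hypothesis vW : v \notin W.
Local Notation N := (nbh e W v).

Lemma isC_paint o x : isC W x -> o != None -> {in N, forall u, x u != o} ->
  isC (v |: W) (paint v o x).
Proof.
move=> /isCP[H1 H2] no Ho.
have evW u : u \in W -> e v u -> o != x u.
  by move=> uW evu; rewrite eq_sym Ho // inE uW.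
apply/isCP; split=> [u|u u']; rewrite !ffunE in_setU1.
  by case: (eqVneq u v) => [->|_] /=; rewrite ?H1.
rewrite in_setU1; case: (eqVneq u v) => [->|nu] /=; case: (eqVneq u' v) => [->|nu'] //= uW u'W.
- by rewrite irrE.
- exact: evW.
- by rewrite symE eq_sym; apply: evW.
exact: H2.
Qed.

Lemma isC_extend a : isC W a.1 -> isC (v |: N) a.2 -> res N a.1 = res N a.2 ->
  isC (v |: W) (extend v a).
Proof.
move=> H1 /isCP[H3 H4] /eqP/res_eqP H; apply: isC_paint => //; first by rewrite H3 setU11.
move=> u uN; rewrite H // H4 ?setU11 ?setU1r //.
by move: uN; rewrite inE symE => /andP[].
Qed.

(** The relation is the one delivered by [weave]. Its last clause prevents recoloring [v] and a
    vertex of [W] at once: if both coordinates move, the coloring of [N] changes, so the single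
    change in the second coordinate lies in [N] and not at [v]. *)
Lemma step_extend a b : isC W a.1 -> isC (v |: N) a.2 ->
  [&& (a.1 == b.1) || step W a.1 b.1, (a.2 == b.2) || step (v |: N) a.2 b.2,
      res N a.1 == res N a.2, res N b.1 == res N b.2 &
      (res N a.1 == res N b.1) ==> ((a.1 == b.1) || (a.2 == b.2))] ->
  [/\ isC W b.1, isC (v |: N) b.2 & step (v |: W) (extend v a) (extend v b)].
Proof.
move=> Ha1 Ha2 /and5P[S1 S2 /eqP Ea /eqP Eb /implyP Hsync].
have Hb1 : isC W b.1 by case/orP: S1 => [/eqP<-//|/step_isCr].
have Hb2 : isC (v |: N) b.2 by case/orP: S2 => [/eqP<-//|/step_isCr].
split=> //; apply/stepP; split; try exact: isC_extend.
have main u : a.2 v != b.2 v -> a.1 u != b.1 u -> False.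
  move=> nv nu; have n2 : a.2 != b.2 by apply: contraNneq nv => ->.
  have n1 : a.1 != b.1 by apply: contraNneq nu => ->.
  move: S2 Hsync; rewrite (negbTE n1) (negbTE n2) /= => /stepP[_ _ H2].
  case: (boolP (res N a.1 == res N b.1)) => [_ /(_ isT)//|/res_eqP nr _].
  case: nr => w wN; apply/eqP/negPn/negP => nw.
  move/eqP/res_eqP: Ea => /(_ w wN) Ea; move/eqP/res_eqP: Eb => /(_ w wN) Eb.
  rewrite Ea Eb in nw; have Ewv := H2 w v nw nv.
  by move: wN; rewrite Ewv inE (negbTE vW).
move=> u u'; rewrite !ffunE.
case: (eqVneq u v) => [->|nu]; case: (eqVneq u' v) => [->|nu'] // d d'.
- by case: (main u').
- by case: (main u).
case/orP: S1 => [/eqP E|/stepP[_ _ H]]; last exact: H.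
by rewrite E eqxx in d.
Qed.

End Extend.

(* The path is built on a growing set [W]; at an added vertex [v] with neighborhood [N] it
   is woven with the reduced trace of the given path on [v |: N]. *)
Lemma reduce_on_cliques T x0 p0 :
  2 <= k -> chordal e -> l_connected (k - 2) e ->
  clique e T -> k - 2 <= #|T| ->
  isC setT x0 -> path (step setT) x0 p0 ->
  exists p, [/\ path (step setT) x0 p, last x0 p = last x0 p0 &
    forall K, clique e K -> k - 2 <= #|K| ->
      dd (map (res K) (x0 :: p)) = red (map (res K) (x0 :: p0))].
Proof.
move=> k2 chE lc cT kT Hx0 Hp0.
pose Phi W := exists p, [/\ path (step W) (res W x0) p,
    last (res W x0) p = res W (last x0 p0) &
    forall K, K \subset W -> clique e K -> k - 2 <= #|K| ->
      dd (map (res K) (res W x0 :: p)) = red (map (res K) (x0 :: p0))].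
have contract := red_res_contract k2 Hx0 Hp0.
suff [p [H1 H2 H3]] : Phi setT.
  have Ex : res setT x0 = x0 by rewrite res_id.
  rewrite Ex in H1 H2 H3.
  exists p; split=> [//||K cK kK]; last by rewrite H3.
  rewrite H2 res_id //.
  by elim: (p0) (x0) Hx0 Hp0 => //= y q IHq x Hx /andP[/step_isCr /IHq].
have redW W : exists t, red (map (res W) (x0 :: p0)) = res W x0 :: t /\
    path (step W) (res W x0) t /\ last (res W x0) t = res W (last x0 p0).
  have [t Et] := red_cons (res W x0) (map (res W) p0); exists t; split=> //; split.
    by have := path_red (path_res (subsetT W) Hp0); rewrite Et.
  have := red_last (res W x0) (res W x0) (map (res W) p0); rewrite Et last_map.
  by [].
apply: (clique_ind symE irrE chE lc cT kT).
  (* On [T] itself the reduced trace serves as the path. *)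
  have [t [Et [pt lt]]] := redW T; exists t; split=> // K sK cK kK.
  by rewrite -Et contract.
move=> W v sTW vW cN kN [p [H1 H2 H3]].
set N := nbh e W v in cN kN *; set K' := v |: N.
have sNW : N \subset W by apply/subsetP => u; rewrite inE => /andP[].
have cK' : clique e K' := clique_nbhU1 symE cN.
have sNK : N \subset K' by rewrite subsetUr.
have [R [ER [pR lR]]] := redW K'.
(* Both sides are the reduced trace on [N] of the given path: the left by the invariant, the right
   by contraction from [K']. *)
have Esync : dd (map (res N) (res W x0 :: p)) = dd (map (res N) (res K' x0 :: R)).
  by rewrite H3 // -ER contract.
have [w [W1 W2 W3]] := weave H1 pR Esync.
have isx0 K : isC K (res K x0) by apply: isC_res Hx0; apply: subsetT.
have E0 : extend v (res W x0, res K' x0) = res (v |: W) x0.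
  apply/ffunP => u; rewrite !ffunE in_setU1 setU11.
  by case: (eqVneq u v) => [->|].
have lastw : last (res W x0, res K' x0) w = (res W (last x0 p0), res K' (last x0 p0)).
  rewrite [LHS]surjective_pairing; congr (_, _).
    have := congr1 (last (res W x0)) W2; rewrite [map _ _]/= !dd_last H2 => <-.
    exact: esym (last_map fst w (res W x0, res K' x0)).
  have := congr1 (last (res K' x0)) W3; rewrite [map _ _]/= !dd_last lR => <-.
  exact: esym (last_map snd w (res W x0, res K' x0)).
have sync : {in (res W x0, res K' x0) :: w, forall a, res N a.1 = res N a.2}.
  move=> a; rewrite inE => /orP[/eqP->|]; first by rewrite /= !resK.
  elim: w (res W x0, res K' x0) W1 {W2 W3 lastw E0} => // b w IHw c /=
    /andP[/and5P[_ _ _ /eqP Eb _] pw].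
  by rewrite inE => /orP[/eqP->//|/(IHw _ pw)].
exists (map (extend v) w); split.
- rewrite -E0.
  have s1 : isC W (res W x0, res K' x0).1 by [].
  have s2 : isC K' (res W x0, res K' x0).2 by [].
  move: (res W x0, res K' x0) s1 s2 W1 {W2 W3 lastw E0 sync}.
  elim: w => // b w IHw a Ha1 Ha2 /= /andP[sab pw].
  by have [Hb1 Hb2 ->] := step_extend vW Ha1 Ha2 sab; apply: IHw.
- rewrite -E0 last_map lastw; apply/ffunP => u; rewrite !ffunE in_setU1 setU11.
  by case: (eqVneq u v) => [->|].
move=> K sK cK kK; rewrite -E0 -[_ :: _]/(map (extend v) (_ :: w)) -map_comp.
(* A clique containing [v] lies in [K'] and is read off the second coordinate; any other lies in [W]
   and is read off the first. *)
have [vK|vK] := boolP (v \in K).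
  have sKK' : K \subset K'.
    apply/subsetP => u uK; rewrite in_setU1; case: (eqVneq u v) => //= nuv.
    rewrite inE (cK v u) // 1?eq_sym // andbT.
    by have := subsetP sK u uK; rewrite in_setU1 (negbTE nuv).
  have -> : map (res K \o extend v) ((res W x0, res K' x0) :: w) =
      map (res K) (map snd ((res W x0, res K' x0) :: w)).
    rewrite -map_comp; apply/eq_in_map => a aw; apply/eqP/res_eqP => u uK; rewrite ffunE.
    case: (eqVneq u v) => [->//|nuv]; move/eqP/res_eqP: (sync a aw); apply.
    by have := subsetP sKK' u uK; rewrite in_setU1 (negbTE nuv).
  by rewrite -dd_map W3 -ER dd_map contract.
have sKW : K \subset W.
  apply/subsetP => u uK; have := subsetP sK u uK; rewrite in_setU1.
  by case: (eqVneq u v) => // E; rewrite -E uK in vK.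
have -> : map (res K \o extend v) ((res W x0, res K' x0) :: w) =
    map (res K) (map fst ((res W x0, res K' x0) :: w)).
  rewrite -map_comp; apply/eq_in_map => a _; apply/eqP/res_eqP => u uK; rewrite ffunE.
  by rewrite ifN //; apply: contraNneq vK => <-.
by rewrite -dd_map W2 dd_map H3.
Qed.

(* The [k]-clique [Q] is frozen; growing [Q] to the whole graph, a closed path leaves no
   room for the flips of an added vertex to survive free reduction. *)
Lemma closed_path_trivial Q x0 p0 :
  2 <= k -> chordal e -> l_connected (k - 2) e ->
  clique e Q -> #|Q| = k ->
  isC setT x0 -> path (step setT) x0 p0 -> last x0 p0 = x0 ->
  forall K, clique e K -> k - 2 <= #|K| -> red (map (res K) (x0 :: p0)) = [:: res K x0].
Proof.
move=> k2 chE lc cQ kQ Hx0 Hp0 Elast.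
have isx0 K : isC K (res K x0) by apply: isC_res Hx0; apply: subsetT.
pose Phi W := forall K, K \subset W -> clique e K -> k - 2 <= #|K| ->
  red (map (res K) (x0 :: p0)) = [:: res K x0].
have contract := red_res_contract k2 Hx0 Hp0.
have trivial A K : A \subset K -> clique e K -> k - 2 <= #|A| ->
    red (map (res K) (x0 :: p0)) = [:: res K x0] -> red (map (res A) (x0 :: p0)) = [:: res A x0].
  by move=> sAK cK kA E; rewrite -(contract A K) // E /= resK.
suff H : Phi setT by move=> K; apply: H; apply: subsetT.
have kQ' : k - 2 <= #|Q| by rewrite kQ leq_subr.
apply: (clique_ind symE irrE chE lc cQ kQ').
  move=> K sK _ kK; apply: trivial sK _ _ _ => //; apply: red_const => y.
  case/mapP => z zp ->; apply/eqP/res_eqP => u uQ.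
  (* If [w] changed color, the [k - 1] vertices of [Q :\ w] would leave both [a w] and [b w] free,
     making [k + 1] colors. *)
  have frozen a b : step Q a b -> a = b.
    move=> /stepP[Ha Hb Hab]; apply/ffunP => w; apply/eqP/negPn/negP => nw.
    have wQ : w \in Q.
      by apply: contraNT nw => wQ; rewrite (isC_out Ha wQ) (isC_out Hb wQ).
    have EQ : w |: (Q :\ w) = Q by rewrite setD1K.
    have wQ' : w \notin Q :\ w by rewrite !inE eqxx.
    have := @isC_neq (Q :\ w) w a wQ'; have := @isC_neq (Q :\ w) w b wQ'.
    rewrite EQ => /(_ cQ Hb)[Nb Ib] /(_ cQ Ha)[Na Ia].
    have := @card_clique_colors (Q :\ w) (res (Q :\ w) a) [:: a w; b w].
    have sQ : Q :\ w \subset Q by rewrite subsetDl.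
    move=> /(_ (cliqueS sQ cQ) (isC_res sQ Ha)); rewrite /= inE nw => /(_ isT).
    suff H : {in [:: a w; b w], forall c, c != None /\
        {in Q :\ w, forall u, res (Q :\ w) a u != c}}.
      by move=> /(_ H); have := cardsD1 w Q; rewrite wQ kQ; clear; lia.
    move=> c; rewrite !inE => /orP[]/eqP->; split=> // t tQ; rewrite ffunE tQ; first exact: Ia.
    have -> : a t = b t; last exact: Ib.
    by apply/eqP/negPn/negP => nt; move: tQ; rewrite (Hab _ _ nt nw) !inE eqxx.
  have : res Q z = res Q x0; last by move/eqP/res_eqP; apply.
  elim: (p0) (x0) Hp0 zp => // b p IHp a /= /andP[sab pbp].
  have := frozen _ _ (step_res (subsetT Q) sab) => Eab.
  by rewrite inE => /orP[/eqP->//|/(IHp _ pbp)]; rewrite Eab.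
move=> W v sQW vW cN kN H K sK cK kK.
set N := nbh e W v in cN kN *; set K' := v |: N.
have sNW : N \subset W by apply/subsetP => u; rewrite inE => /andP[].
have vN : v \notin N by apply: contra vW; apply/subsetP.
have [vK|vK] := boolP (v \in K); last first.
  apply: H => //; apply/subsetP => u uK; have := subsetP sK u uK; rewrite in_setU1.
  by case: (eqVneq u v) => // E; rewrite -E uK in vK.
have cK' : clique e K' := clique_nbhU1 symE cN.
have sKK' : K \subset K'.
  apply/subsetP => u uK; rewrite in_setU1; case: (eqVneq u v) => //= nuv.
  rewrite inE (cK v u) // 1?eq_sym // andbT.
  by have := subsetP sK u uK; rewrite in_setU1 (negbTE nuv).
(* Triviality passes to subcliques, so only [K'] itself has to be treated. *)
apply: (trivial _ _ sKK') => //.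
have sNK : N \subset K' by rewrite subsetUr.
have := H N sNW cN kN; rewrite -(contract N K') //.
have [t Et] := red_cons (res K' x0) (map (res K') p0).
have := reduced_red (map (res K') (x0 :: p0)).
have := path_red (path_res (subsetT K') Hp0).
have := red_last (res K' x0) (res K' x0) (map (res K') p0).
rewrite {}Et last_map Elast [last _ _]/= [behead _]/= => lt pt rt /dd_const const.
(* The reduced trace on [K'] is closed and constant on [N]. With one move it could not return to its
   start; with two or more, its first three colorings would be distinct extensions of one coloring
   of [N]. *)
case: t lt pt rt const => [//|y [|z t]] /=.
  by move=> -> _; rewrite eqxx.
move=> _ /and3P[s1 s2 _] /andP[/andP[n1 n2] /andP[/andP[n3 _] _]] const.
have Ey : res N y = res N x0 by apply: const; rewrite !inE eqxx orbT.
have Ez : res N z = res N x0 by apply: const; rewrite !inE eqxx !orbT.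
have Ex : res N (res K' x0) = res N x0 by rewrite resK.
by case: (third_extension vN cK' kN k2 (step_isCl s1) (step_isCr s1) (step_isCr s2)
  _ _ n1 n3 n2); rewrite ?Ex ?Ey ?Ez.
Qed.

End PartialColorings.

(** * Contracted solution graphs *)

Section Contracted.
Variables (k : nat) (V : finType) (e : rel V) (T : {set V}).
Hypotheses (k3 : 3 <= k) (symE : symmetric e) (irrE : irreflexive e) (chE : chordal e).
Hypotheses (lc : l_connected (k - 2) e) (cT : clique e T) (kT : k - 2 <= #|T|).
Local Notation C := {ffun V -> 'I_k}.
Local Notation L := {ffun V -> option 'I_k}.
Local Notation nodes := (cs_nodes k e T).
Local Notation adj := (@cs_adj V k e).
Local Notation lab := (@cs_lab V k T).
Implicit Types (a b : C) (x y : L) (W : {set V}) (X Y Z : {set C}).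

Definition total a : L := [ffun v => Some (a v)].

Lemma restr_res a : restr T a = res T (total a).
Proof. by apply/ffunP => v; rewrite !ffunE. Qed.

Lemma properP a : reflect (forall u v, e u v -> a u != a v) (Defs.proper e a).
Proof.
apply: (iffP forallP) => [H u v|H u]; first by have /forallP/(_ v)/implyP := H u.
by apply/forallP => v; apply/implyP/H.
Qed.

Lemma isC_total a : isC e setT (total a) = Defs.proper e a.
Proof.
apply/isCP/properP => [[_ H] u v euv|H].
  by have := H u v (in_setT _) (in_setT _) euv; rewrite !ffunE.
by split=> [u|u v _ _ /H]; rewrite !ffunE // inE.
Qed.

Lemma isC_total_ex x : isC e setT x -> exists2 a, Defs.proper e a & x = total a.
Proof.
move=> Hx; have /isCP[H _] := Hx.
have ex v : exists c, x v == Some c.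
  by have := H v; rewrite in_setT; case: (x v) => [c|//]; exists c.
have E : x = total [ffun v => xchoose (ex v)].
  by apply/ffunP => v; rewrite !ffunE; apply/eqP/(xchooseP (ex v)).
by exists [ffun v => xchoose (ex v)]; rewrite // -isC_total -E.
Qed.

Lemma total_inj : injective total.
Proof. by move=> a b /ffunP H; apply/ffunP => v; have := H v; rewrite !ffunE => -[]. Qed.

Lemma cadjP a b : reflect [/\ Defs.proper e a, Defs.proper e b &
  exists v, forall u, (a u != b u) = (u == v)] (cadj e a b).
Proof.
apply: (iffP and3P) => -[Ha Hb H]; split=> //.
  by case/cards1P: H => v E; exists v => u;
    have := congr1 (fun D : {set V} => u \in D) E; rewrite !inE.
case: H => v H; apply/cards1P; exists v; apply/setP => u; by rewrite !inE H.
Qed.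

Lemma cadj_sym : symmetric (@cadj V k e).
Proof.
suff H a b : cadj e a b -> cadj e b a by move=> a b; apply/idP/idP; apply: H.
case/cadjP => Ha Hb [v H]; apply/cadjP; split=> //; exists v => u.
by rewrite eq_sym H.
Qed.

Lemma cadj_step a b : cadj e a b -> step e setT (total a) (total b).
Proof.
case/cadjP => Ha Hb [v H]; apply/stepP; split; rewrite ?isC_total //.
by move=> u w; rewrite !ffunE !(inj_eq Some_inj) !H => /eqP-> /eqP.
Qed.

Lemma step_cadj a b : step e setT (total a) (total b) -> a = b \/ cadj e a b.
Proof.
move=> /stepP[]; rewrite !isC_total => Ha Hb H.
have [->|nab] := eqVneq a b; first by left.
right; apply/cadjP; split=> //.
have /existsP[v nv] : [exists v, a v != b v].
  apply: contraNT nab => /existsPn E; apply/eqP/ffunP => v; apply/eqP.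
  by have := E v; rewrite negbK.
exists v => u; apply/idP/eqP => [nu|->//].
by apply: H; rewrite !ffunE !(inj_eq Some_inj).
Qed.

Definition stepT W : rel L := [rel x y | step e W x y && (res T x == res T y)].

Lemma connect_ladj a b : connect (stepT setT) (total a) (total b) -> connect (ladj e T) a b.
Proof.
case/connectP => p; elim: p a => [|y p IH] a /=; first by move=> _ /total_inj->.
move=> /andP[/andP[sy /eqP ry] pp] Eb.
have [c Hc Ey] := isC_total_ex (step_isCr sy); rewrite {y}Ey in sy ry pp Eb.
apply: connect_trans (IH _ pp Eb).
case: (step_cadj sy) => [->//|adjac]; apply: connect1.
by rewrite /ladj /= adjac !restr_res ry eqxx.
Qed.

Lemma path_total a p : path (cadj e) a p -> path (step e setT) (total a) (map total p).
Proof. by apply: homo_path => b c; apply: cadj_step. Qed.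

Lemma map_restr p : map (restr T) p = map (res T) (map total p).
Proof. by rewrite -map_comp; apply: eq_map => a; rewrite restr_res. Qed.

Lemma path_stepT W x q f : path (step e W) x q ->
  {in map (res T) (x :: q), forall z, z = f} -> path (stepT W) x q.
Proof.
elim: q x => //= y q IH x /andP[sxy pq] const.
have Ex : res T x = f by apply: const; rewrite mem_head.
have Ey : res T y = f by apply: const; rewrite !inE eqxx orbT.
rewrite {1}/stepT /= sxy Ex Ey eqxx /=; apply: (IH y pq) => z zq.
by apply: const; rewrite inE zq orbT.
Qed.

(** The replacement path from [reduce_on_cliques] has a constant trace on [T], so it stays inside
    one label component. *)
Lemma trivial_path_ladj a p : Defs.proper e a -> path (cadj e) a p ->
  red (map (restr T) (a :: p)) = [:: restr T a] -> connect (ladj e T) a (last a p).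
Proof.
move=> Ha pp; rewrite map_restr restr_res => E.
have Hx : isC e setT (total a) by rewrite isC_total.
have [q [pq lq Eq]] := reduce_on_cliques symE irrE (ltnW k3) chE lc cT kT Hx (path_total pp).
have := Eq T cT kT; rewrite {}E => {Eq} /dd_const const.
apply: connect_ladj; rewrite last_map in lq; rewrite -lq; apply/connectP; exists q => //.
exact: path_stepT pq const.
Qed.

Lemma lcomp_sym : connect_sym (@ladj V k e T).
Proof. by apply: sym_connect_sym => a b; rewrite /ladj /= cadj_sym eq_sym. Qed.

Lemma connect_ladjP a b : Defs.proper e a -> connect (ladj e T) a b ->
  Defs.proper e b /\ restr T b = restr T a.
Proof.
move=> Ha /connectP[p]; elim: p a Ha => [|c p IH] a Ha /=; first by move=> _ ->.
by move=> /andP[/andP[/cadjP[_ Hc _] /eqP->] pp] Eb; apply: (IH c Hc pp Eb).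
Qed.

Lemma lcomp_id a : a \in lcomp e T a.
Proof. by rewrite inE connect0. Qed.

Lemma nodeP X a : X \in nodes -> a \in X ->
  [/\ Defs.proper e a, X = lcomp e T a & lab X = restr T a].
Proof.
case/imsetP => c; rewrite inE => Hc -> {X}; rewrite inE => ca.
have [Ha Ea] := connect_ladjP Hc ca; split=> //.
  by apply/setP => b; rewrite !inE (same_connect lcomp_sym ca).
rewrite /cs_lab; case: pickP => [d|/(_ c)]; last by rewrite lcomp_id.
by rewrite inE Ea => cd; have [] := connect_ladjP Hc cd.
Qed.

Lemma node_lcomp a : Defs.proper e a -> lcomp e T a \in nodes.
Proof. by move=> Ha; apply: imset_f. Qed.

Lemma node_ex X : X \in nodes -> exists a, a \in X.
Proof. by case/imsetP => a _ ->; exists a; apply: lcomp_id. Qed.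

Lemma eq_node X Y a b : X \in nodes -> Y \in nodes -> a \in X -> b \in Y ->
  connect (ladj e T) a b -> X = Y.
Proof.
move=> HX HY aX bY cab; have [_ -> _] := nodeP HX aX; have [_ -> _] := nodeP HY bY.
by apply/setP => c; rewrite !inE (same_connect lcomp_sym cab).
Qed.

Lemma adjP X Y : reflect (X != Y /\ exists a b, [/\ a \in X, b \in Y & cadj e a b]) (adj X Y).
Proof.
apply: (iffP andP) => -[nXY].
  by case/exists_inP => a aX /exists_inP[b bY ab]; split=> //; exists a, b.
move=> [a [b [aX bY ab]]]; split=> //.
by apply/exists_inP; exists a => //; apply/exists_inP; exists b.
Qed.

Lemma adj_sym X Y : adj X Y -> adj Y X.
Proof.
case/adjP => nXY [a [b [aX bY ab]]]; apply/adjP; split; first by rewrite eq_sym.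
by exists b, a; rewrite cadj_sym.
Qed.

Lemma adj_lab X Y : X \in nodes -> Y \in nodes -> adj X Y -> lab X != lab Y.
Proof.
move=> HX HY /adjP[nXY [a [b [aX bY ab]]]]; apply: contra_neq nXY.
have [_ _ ->] := nodeP HX aX; have [_ _ ->] := nodeP HY bY => E.
apply: (eq_node HX HY aX bY); apply: connect1; by rewrite /ladj /= ab E eqxx.
Qed.

(** Walks of the contracted graph lift to recoloring paths. The detours inside a label component
    keep the label constant and vanish under reduction. *)
Lemma node_walk X s a b : X \in nodes -> {subset s <= nodes} -> path adj X s ->
  a \in X -> b \in last X s ->
  exists p, [/\ path (cadj e) a p, last a p = b &
    red (map (restr T) (a :: p)) = red (map lab (X :: s))].
Proof.
have inX Y c d : Y \in nodes -> c \in Y -> d \in Y -> exists p,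
    [/\ path (cadj e) c p, last c p = d & {in map (restr T) p, forall f, f = restr T c}].
  move=> HY cY; have [Hc -> _] := nodeP HY cY; rewrite inE => /connectP[p pp ->].
  exists p; split=> //.
    by apply: sub_path pp => x y; rewrite /ladj /= => /andP[].
  elim: p c pp {cY Hc} => [//|y p IH] c /= /andP[/andP[_ /eqP ->] pp] f.
  by rewrite inE => /orP[/eqP//|]; apply: IH.
elim: s X a => [|Y s IH] X a HX Hs /=.
  move=> _ aX bX; have [p [pp lp const]] := inX X a b HX aX bX.
  exists p; split=> //; have [_ _ ->] := nodeP HX aX.
  exact: red_const.
move=> /andP[aXY ps] aX bl; have HY : Y \in nodes by apply: Hs; rewrite mem_head.
have /adjP[_ [a1 [b1 [a1X b1Y ab1]]]] := aXY.
have [p [pp lp Ep]] := inX X a a1 HX aX a1X.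
have [|q [pq lq Eq]] := IH Y b1 HY _ ps b1Y bl.
  by move=> Z Zs; apply: Hs; rewrite inE Zs orbT.
exists (p ++ b1 :: q); split.
- by rewrite cat_path pp lp /= ab1.
- by rewrite last_cat.
rewrite map_cat.
rewrite -[LHS]/(red (restr T a :: map (restr T) p ++ map (restr T) (b1 :: q))).
rewrite red_cat_const //; have [_ _ ->] := nodeP HX aX.
by rewrite -[LHS]/(push (restr T a) (red (map (restr T) (b1 :: q)))) Eq.
Qed.

(** If two neighbors [Y] and [Z] of [X] share a label, the walk from [Y] over [X] to [Z] is a
    backtrack on labels. Its lift has a trivial reduced trace, so [Y] and [Z] are the same
    component. *)
Lemma nodes_INP : INP nodes adj lab.
Proof.
move=> X Y Z HX HY HZ XY XZ nYZ E.
have [b bY] := node_ex HY; have [c cZ] := node_ex HZ.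
have [||p [pp lp Ep]] := @node_walk Y [:: X; Z] b c HY _ _ bY cZ.
- by move=> W; rewrite !inE => /orP[]/eqP->.
- by rewrite /= (adj_sym XY) XZ.
case/eqP: nYZ; apply: (eq_node HY HZ bY cZ); rewrite -lp.
have [Hb _ Elab] := nodeP HY bY.
apply: trivial_path_ladj => //; rewrite Ep /= -E -Elab.
have [EXY|nXY] := eqVneq (lab X) (lab Y); rewrite /= ?EXY ?eqxx //.
by rewrite eq_sym (negbTE nXY).
Qed.

(** Along a cycle, labels one apart differ by [adj_lab] and labels two apart differ by the injective
    neighborhood property. The label word of length [n + 1] is therefore reduced, while its lift is
    a closed path, whose trace must reduce to one letter. *)
Lemma nodes_forest Q : clique e Q -> #|Q| = k -> forest nodes adj.
Proof.
move=> cQ kQ n c n3 injc cnode cadjc; have n0 : 0 < n by apply: leq_trans n3.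
have last_iota l : last 0 (iota 1 l) = l.
  by case: l => // l; rewrite -nth_last size_iota nth_iota.
(* Indices are taken modulo [n], so that [D 0] up to [D n] is a closed walk. *)
pose D i := c (Ordinal (ltn_pmod i n0)).
have HD i : D i \in nodes by apply: cnode.
have aD i : adj (D i) (D i.+1).
  by apply: cadjc => /=; apply/eqP; rewrite -[in RHS]addn1 modnDml addn1.
(* This uses [3 <= n]: positions two apart on the cycle are distinct. *)
have nD i : D i != D i.+2.
  apply/eqP => /injc [] /eqP; rewrite -addn2 -{1}[i]addn0 eqn_modDl.
  by rewrite mod0n modn_small.
have red_lab m l : reduced (map (lab \o D) (iota m l)).
  apply: reduced_mkseq => i; first exact: adj_lab.
  apply/eqP => E; apply: (nodes_INP (HD i.+1) (HD i) (HD i.+2)) E => //.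
  exact: adj_sym.
have [a aX] := node_ex (HD 0).
have [||||p [pp lp]] := @node_walk (D 0) (map D (iota 1 n)) a a (HD 0).
- by move=> X /mapP[i _ ->].
- by elim: (n) (0) => //= l IH i; rewrite aD IH.
- exact: aX.
- have -> : last (D 0) (map D (iota 1 n)) = D n.
    by rewrite last_map last_iota.
  by rewrite (_ : D n = D 0) //; congr c; apply: val_inj; rewrite /= modnn mod0n.
have [Ha _ _] := nodeP (HD 0) aX.
have Hx : isC e setT (total a) by rewrite isC_total.
rewrite map_restr -[map total (a :: p)]/(total a :: map total p).
rewrite (closed_path_trivial symE irrE (ltnW k3) chE lc cQ kQ Hx (path_total pp)) //.
  rewrite -[D 0 :: _]/(map D (iota 0 n.+1)) -map_comp red_reduced //.
  by move=> /(congr1 size); rewrite size_map size_iota => -[E]; rewrite -E in n3.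
by rewrite last_map lp.
Qed.

(** * Graphs without a clique on [k] vertices *)

Section NoLargeClique.
Hypothesis nbh_le : forall W v, v \notin W -> clique e (nbh e W v) -> #|nbh e W v| <= k - 2.

Lemma avoid_colors (F : {set option 'I_k}) : #|F| < k -> exists c : 'I_k, Some c \notin F.
Proof.
move=> Fk; have [/existsP[c Hc]|/existsPn H] := boolP [exists c : 'I_k, Some c \notin F].
  by exists c.
move: Fk; rewrite ltnNge => /negP[].
have sub : [set Some c | c : 'I_k] \subset F.
  by apply/subsetP => _ /imsetP[c _ ->]; have := H c; rewrite negbK.
by have := subset_leq_card sub; rewrite card_imset ?card_ord //; apply: Some_inj.
Qed.

(** The neighborhood uses at most [k - 2] colors, so even with one further color [o] reserved for
    later use, a color remains for [v]. *)
Lemma avoid_nbh W v (f : V -> option 'I_k) o : v \notin W -> clique e (nbh e W v) ->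
  exists c : 'I_k, Some c != o /\ {in nbh e W v, forall u, f u != Some c}.
Proof.
move=> vW cN; have [|c] := @avoid_colors (o |: [set f u | u in nbh e W v]).
  rewrite cardsU1.
  apply: leq_ltn_trans (leq_add (leq_b1 _) (leq_trans (leq_imset_card _ _) (nbh_le vW cN))) _.
  by move: k3; clear; lia.
rewrite in_setU1 negb_or => /andP[nc Hc]; exists c; split=> // u uN.
by apply: contraNneq Hc => <-; apply: imset_f.
Qed.

(** Keeping [b] off the neighbors of [t] makes it possible to recolor [t] to [b] afterwards. Every
    vertex added outside [T] simply avoids [b]. *)
Lemma extend_coloring (f : L) t (b : 'I_k) : K_coloring T f ->
  {in T, forall u, e u t -> f u != Some b} ->
  exists a, [/\ Defs.proper e a, restr T a = f & forall u, e u t -> a u != b].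
Proof.
move=> [Hf1 Hf2] Hb.
pose Phi W := exists x, [/\ isC e W x, res T x = f & {in W, forall u, e u t -> x u != Some b}].
suff [x [Hx rx xb]] : Phi setT.
  have [a Ha Ex] := isC_total_ex Hx; exists a; split=> //.
    by rewrite restr_res -Ex.
  by move=> u /(xb u (in_setT _)); rewrite Ex ffunE (inj_eq Some_inj).
apply: (clique_ind symE irrE chE lc cT kT).
  exists f; have Hf : isC e T f.
    apply/isCP; split=> // u v uT vT euv; apply: Hf2 => //.
    by apply: contraTneq euv => ->; rewrite irrE.
  by split=> //; apply: res_id Hf.
move=> W v sTW vW cN _ [x [Hx rx xb]].
have [c [nc Hc]] := avoid_nbh x (Some b) vW cN.
exists (paint v (Some c) x); split.
- exact: isC_paint.
- rewrite -rx; apply/eqP/res_eqP => u uT; rewrite ffunE ifN //.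
  by apply: contraNneq vW => <-; apply: (subsetP sTW).
move=> u; rewrite in_setU1 ffunE; case: (eqVneq u v) => [//|_] /=; exact: xb.
Qed.

(** First [v] moves to a color [c] that fits its neighbors both before and after the given step,
    then that step is made. The color [y s] taken by the moving vertex [s] is the one reserved in
    the choice of [c]. *)
Lemma lift_step W v x y : T \subset W -> v \notin W -> clique e (nbh e W v) ->
  isC e (v |: W) x -> stepT W (res W x) y ->
  exists2 z, isC e (v |: W) z /\ res W z = y & connect (stepT (v |: W)) x z.
Proof.
move=> sTW vW cN Hx /andP[sxy /eqP rxy].
have /stepP[Hx' Hy Hd] := sxy.
have [s Hs] : exists s, forall u, u != s -> res W x u = y u.
  have [/existsP[s ns]|/existsPn H] := boolP [exists s, res W x s != y s].
    exists s => u nus; apply/eqP/negPn/negP => nu; case/eqP: nus; exact: Hd.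
  by exists v => u _; apply/eqP; have := H u; rewrite negbK.
have [c [nc Hc]] := avoid_nbh (res W x) (y s) vW cN.
have Hc' : {in nbh e W v, forall u, y u != Some c}.
  move=> u uN; have [->|nus] := eqVneq u s; first by rewrite eq_sym.
  by rewrite -Hs // Hc.
have H1 : isC e (v |: W) (paint v (Some c) (res W x)) by apply: isC_paint.
have H2 : isC e (v |: W) (paint v (Some c) y) by apply: isC_paint.
have resP w : isC e W w -> res W (paint v (Some c) w) = w.
  move=> Hw; rewrite -{2}(res_id Hw); apply/eqP/res_eqP => u uW; rewrite ffunE ifN //.
  by apply: contraNneq vW => <-.
have resT w w' : res W w = res W w' -> res T w = res T w'.
  by move=> E; rewrite -(resK w sTW) E resK.
exists (paint v (Some c) y); first by rewrite resP.
apply: (@connect_trans _ _ (paint v (Some c) (res W x))); apply: connect1; apply/andP; split.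
- apply/stepP; split=> // u u' nu nu'.
  suff Hv w : x w != paint v (Some c) (res W x) w -> w = v by rewrite (Hv u) // (Hv u').
  rewrite !ffunE; case: (eqVneq w v) => [//|nwv]; case: (boolP (w \in W)) => wW.
    by rewrite eqxx.
  by rewrite (isC_out Hx) // in_setU1 (negbTE nwv).
- by apply/eqP/resT; rewrite resP.
- apply/stepP; split=> // u u'; rewrite 2![paint _ _ _ u]ffunE 2![paint _ _ _ u']ffunE.
  case: (eqVneq u v) => [_|_]; first by rewrite eqxx.
  by case: (eqVneq u' v) => [_|_]; [rewrite eqxx | apply: Hd].
have rT w : isC e W w -> res T (paint v (Some c) w) = res T w.
  by move=> Hw; apply: resT; rewrite resP // (res_id Hw).
by apply/eqP; rewrite (rT _ Hx') (rT _ Hy).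
Qed.

(** By growth from [T]: a connecting path on [W] is lifted step by step to [v |: W]. The coloring
    reached agrees with the target on [W], and one last step corrects [v]. *)
Lemma restr_connect a b : Defs.proper e a -> Defs.proper e b -> restr T a = restr T b ->
  connect (ladj e T) a b.
Proof.
rewrite -!isC_total !restr_res => Ha Hb rab; apply: connect_ladj.
pose Phi W := forall x y, isC e W x -> isC e W y -> res T x = res T y -> connect (stepT W) x y.
suff H : Phi setT by apply: H.
apply: (clique_ind symE irrE chE lc cT kT).
  by move=> x y Hx Hy; rewrite (res_id Hx) (res_id Hy) => ->.
move=> W v sTW vW cN _ IH x y Hx Hy rxy.
have sW : W \subset v |: W by apply: subsetUr.
have resT (w : L) : res T (res W w) = res T w by rewrite resK.
have := IH (res W x) (res W y) (isC_res sW Hx) (isC_res sW Hy).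
rewrite !resT => /(_ rxy) /connectP[p].
elim: p x Hx {rxy} => [|x' p IHp] x Hx /=.
  move=> _ Exy; apply: connect1; apply/andP; split; last by rewrite -(resT x) -Exy resT.
  apply/stepP; split=> // u u' nu nu'.
  suff Hv w : x w != y w -> w = v by rewrite (Hv u) // (Hv u').
  move=> nw; apply/eqP; apply: contraNT nw => nwv; have [wW|wW] := boolP (w \in W).
    by move/eqP/res_eqP: Exy => /(_ w wW) ->.
  by rewrite (isC_out Hx) ?(isC_out Hy) // in_setU1 (negbTE nwv).
move=> /andP[sx pp] Ey.
have [z [Hz rz] cxz] := lift_step sTW vW cN Hx sx.
apply: connect_trans cxz (IHp z Hz _ _); by rewrite rz.
Qed.

Lemma nodes_color_complete : color_complete nodes adj #|T| lab.
Proof.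
have KC a : Defs.proper e a -> K_coloring T (restr T a).
  move=> /properP Ha; split=> [v|u v uT vT nuv]; first by rewrite ffunE; case: ifP.
  by rewrite !ffunE uT vT (inj_eq Some_inj) Ha // cT.
have eq_lab X Y : X \in nodes -> Y \in nodes -> lab X = lab Y -> X = Y.
  move=> HX HY; have [a aX] := node_ex HX; have [b bY] := node_ex HY.
  have [Ha _ ->] := nodeP HX aX; have [Hb _ ->] := nodeP HY bY => E.
  exact: (eq_node HX HY aX bY (restr_connect Ha Hb E)).
have labKC X : X \in nodes -> K_coloring T (lab X).
  by move=> HX; have [a aX] := node_ex HX; have [Ha _ ->] := nodeP HX aX; apply: KC.
exists T; split=> //.
  move=> f Hf; have [Hf1 Hf2] := Hf.
  have /set0Pn[t tT] : T != set0.
    by rewrite -card_gt0; apply: leq_trans kT; rewrite subn_gt0.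
  have [b Eb] : exists b : 'I_k, f t = Some b.
    by have := Hf1 t; rewrite tT; case: (f t) => [b|//]; exists b.
  (* Only existence of an extension is wanted here, so the color that [t] already has is taken for
     [b]. *)
  have [|a [Ha ra _]] := @extend_coloring f t b Hf.
    move=> u uT eut; rewrite -Eb; apply: Hf2 => //.
    by apply: contraTneq eut => ->; rewrite irrE.
  have [_ _ lX] := nodeP (node_lcomp Ha) (lcomp_id a).
  exists (lcomp e T a); split; rewrite ?node_lcomp ?lX //.
  by move=> Y HY lY; apply: eq_lab; rewrite ?node_lcomp // lY lX.
move=> X Y HX HY; split.
  move=> /[dup] /(adj_lab HX HY) nl /adjP[_ [a [b [aX bY /cadjP[Ha Hb [v Hv]]]]]].
  have [_ _ lX] := nodeP HX aX; have [_ _ lY] := nodeP HY bY.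
  rewrite lX lY in nl *; have vT : v \in T.
    apply: contraNT nl => vT; apply/eqP/ffunP => u; rewrite !ffunE.
    case: (boolP (u \in T)) => // uT; congr Some; apply/eqP/negPn; rewrite Hv.
    by apply: contraNneq vT => <-.
  apply/eqP/cards1P; exists v; apply/setP => u; rewrite !inE !ffunE.
  case: (boolP (u \in T)) => [uT|uT] /=; first by rewrite (inj_eq Some_inj) Hv.
  by apply/esym/negbTE; apply: contraNneq uT => ->.
move=> /eqP/cards1P[t Et].
have inD u : u \in T -> (lab X u != lab Y u) = (u == t).
  by move=> uT; have := congr1 (fun D : {set V} => u \in D) Et; rewrite !inE uT.
have tT : t \in T by have := set11 t; rewrite -Et inE => /andP[].
have [Y1 Y2] := labKC Y HY.
have [b Eb] : exists b : 'I_k, lab Y t = Some b.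
  by have := Y1 t; rewrite tT; case: (lab Y t) => [b|//]; exists b.
(* The edge is realized by a coloring [a] with label [lab X] in which [t] may switch to its color
   [b] in [lab Y]; the switch gives [a']. *)
have [|a [Ha ra nab]] := @extend_coloring (lab X) t b (labKC X HX).
  move=> u uT eut; have nut : u != t by apply: contraTneq eut => ->; rewrite irrE.
  have := inD u uT; rewrite (negbTE nut) => /negbFE/eqP ->; rewrite -Eb; exact: Y2.
pose a' : C := [ffun u => if u == t then b else a u].
have nat : a t != b.
  by have := inD t tT; rewrite eqxx -ra Eb ffunE tT (inj_eq Some_inj).
have Ha' : Defs.proper e a'.
  apply/properP => u v euv; rewrite !ffunE.
  case: (eqVneq u t) euv => [->|nu]; case: (eqVneq v t) => [->|nv] euv.
  - by rewrite irrE in euv.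
  - by rewrite eq_sym nab // symE.
  - exact: nab.
  by have /properP := Ha; apply.
have ra' : restr T a' = lab Y.
  apply/ffunP => u; rewrite !ffunE; case: (boolP (u \in T)) => uT; last first.
    by apply/esym/eqP; rewrite -[_ == _]negbK Y1.
  case: (eqVneq u t) => [->//|nu].
  by have := inD u uT; rewrite (negbTE nu) => /negbFE/eqP <-; rewrite -ra ffunE uT.
have [_ _ l1] := nodeP (node_lcomp Ha) (lcomp_id a).
have [_ _ l2] := nodeP (node_lcomp Ha') (lcomp_id a').
have EX : X = lcomp e T a by apply: eq_lab; rewrite ?node_lcomp // l1.
have EY : Y = lcomp e T a' by apply: eq_lab; rewrite ?node_lcomp // l2.
apply/adjP; split.
  by apply/eqP => E; have := inD t tT; rewrite E !eqxx.
exists a, a'; rewrite EX EY !lcomp_id; split=> //; apply/cadjP; split=> //.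
by exists t => u; rewrite ffunE; case: (eqVneq u t) => [->|]; rewrite ?eqxx.
Qed.

End NoLargeClique.

Lemma card_clique_le Q a : Defs.proper e a -> clique e Q -> #|Q| <= k.
Proof.
rewrite -isC_total => Ha cQ.
have := @card_clique_colors k V e Q (res Q (total a)) [::] cQ (isC_res (subsetT Q) Ha) isT.
by rewrite addn0; apply.
Qed.

End Contracted.

Theorem theorem1 (k : nat) (V : finType) (e : rel V) (T : {set V}) :
  3 <= k ->
  simple_graph e ->
  l_connected (k - 2) e ->
  colorable k e ->
  chordal e ->
  clique e T ->
  k - 2 <= #|T| ->
  color_complete (cs_nodes k e T) (@cs_adj V k e) #|T| (@cs_lab V k T)
  \/ (forest (cs_nodes k e T) (@cs_adj V k e) /\
      INP (cs_nodes k e T) (@cs_adj V k e) (@cs_lab V k T)).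
Proof.
move=> k3 [symE irrE] lc [a Ha] chE cT kT.
pose cliqueb (Q : {set V}) := [forall u in Q, forall v in Q, (u != v) ==> e u v].
have cliqueP Q : reflect (clique e Q) (cliqueb Q).
  apply: (iffP forall_inP) => [H u v uQ vQ nuv|H u uQ].
    by have /forall_inP/(_ v vQ)/implyP := H u uQ; apply.
  by apply/forall_inP => v vQ; apply/implyP; apply: H.
have [/existsP[Q /andP[/cliqueP cQ /eqP kQ]]|noQ] := boolP [exists Q, cliqueb Q && (#|Q| == k)].
  by right; split; [apply: nodes_forest cQ kQ | apply: nodes_INP].
left; apply: nodes_color_complete => // W v vW cN.
have cK := clique_nbhU1 symE cN.
have le := card_clique_le Ha cK.
have ne : #|v |: nbh e W v| != k.
  apply: contraNneq noQ => E; apply/existsP; exists (v |: nbh e W v).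
  by rewrite E eqxx andbT; apply/cliqueP.
(* The clique [v |: nbh e W v] has at most [k] vertices by colorability and not exactly [k], which
   leaves at most [k - 2] neighbors. *)
move: le ne; rewrite cardsU1 inE (negbTE vW) /=; clear; lia.
Qed.
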